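(* Let $T$ be a maximal torus in $G_2$. The variety $CG$ contains exactly $15$ fixed points of $T$.
   Context: $\mathbb{O}$ denotes the complexified algebra of octonions, with unit $1$ and multiplicative norm $q$; $\mathrm{Im}(\mathbb{O})=1^{\perp}$ is the seven dimensional space of imaginary octonions, and $G_2=\mathrm{Aut}(\mathbb{O})$. Subalgebras of $\mathbb{O}$ are understood to contain the unit. $CG$ is the set of four dimensional subalgebras $\mathbb{A}$ of $\mathbb{O}$, considered via $\mathbb{A}\mapsto \mathrm{Im}(\mathbb{A})=\mathbb{A}\cap\mathrm{Im}(\mathbb{O})$ as a closed $G_2$-stable subvariety of $G(3,\mathrm{Im}(\mathbb{O}))$. *)

(* Defs.v *)
From HB Require Import structures.
From mathcomp Require Import all_boot all_order all_algebra.
From mathcomp Require Import mathcomp_extra boolp classical_sets functions.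
From mathcomp Require Import cardinality reals.
From mathcomp Require Import complex.
From mathcomp Require mpoly.

Set Implicit Arguments.
Unset Strict Implicit.
Unset Printing Implicit Defensive.

Import Order.TTheory GRing.Theory Num.Theory.

Local Open Scope classical_set_scope.
Local Open Scope ring_scope.

(** ** Octonions over a field, by iterated Cayley-Dickson doubling *)

(* [cd_dim n] is 2 ^ n, in a form that exposes the splitting into halves;
   in particular [cd_dim 3] computes to 8. *)
Fixpoint cd_dim (n : nat) : nat :=
  if n is m.+1 then (cd_dim m + cd_dim m)%N else 1%N.

Section CayleyDickson.
Variable F : fieldType.

(* The conjugation on the base field is trivial.  For F = R[i] the algebras
   below are therefore the complexifications of the real Cayley-Dickson
   algebras (see [map_cd_mul]), and conjugation is C-linear. *)
Fixpoint cd_conj (n : nat) : 'cV[F]_(cd_dim n) -> 'cV[F]_(cd_dim n) :=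
  match n with
  | 0 => fun x => x
  | m.+1 => fun x => col_mx (cd_conj (usubmx x)) (- dsubmx x)
  end.

(* (a, b) (c, d) = (a c - d^* b, d a + b c^* ) *)
Fixpoint cd_mul (n : nat) :
    'cV[F]_(cd_dim n) -> 'cV[F]_(cd_dim n) -> 'cV[F]_(cd_dim n) :=
  match n with
  | 0 => fun x y => x *m y
  | m.+1 => fun x y =>
      let a := usubmx x in let b := dsubmx x in
      let c := usubmx y in let d := dsubmx y in
      col_mx (cd_mul a c - cd_mul (cd_conj d) b)
             (cd_mul d a + cd_mul b (cd_conj c))
  end.

Fixpoint cd_one (n : nat) : 'cV[F]_(cd_dim n) :=
  if n is m.+1 then col_mx (cd_one m) 0 else 1%:M.

End CayleyDickson.

Lemma map_cd_conj (F K : fieldType) (f : {rmorphism F -> K}) n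
    (x : 'cV[F]_(cd_dim n)) :
  map_mx f (cd_conj x) = cd_conj (map_mx f x).
Proof.
elim: n x => [//|n IHn] x /=.
by rewrite map_col_mx IHn map_mxN map_usubmx map_dsubmx.
Qed.

Lemma map_cd_mul (F K : fieldType) (f : {rmorphism F -> K}) n
    (x y : 'cV[F]_(cd_dim n)) :
  map_mx f (cd_mul x y) = cd_mul (map_mx f x) (map_mx f y).
Proof.
elim: n x y => [|n IHn] x y /=; first by rewrite map_mxM.
rewrite map_col_mx map_mxB map_mxD !IHn !map_cd_conj.
by rewrite !map_usubmx !map_dsubmx.
Qed.

Section Octonions.
Variable F : fieldType.

Notation oct := 'cV[F]_(cd_dim 3).

Definition oct_mul (x y : oct) : oct := cd_mul x y.

Definition oct_one : oct := cd_one F 3.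

Definition oct_norm (x : oct) : F := \sum_i x i 0 ^+ 2.

Definition oct_polar (x y : oct) : F :=
  oct_norm (x + y) - oct_norm x - oct_norm y.

(* The orthogonal of 1; see [memv_oct_im]. *)
Definition oct_im : {vspace oct} :=
  lker (linfun (fun x : oct => oct_polar oct_one x : F^o)).

Lemma oct_polarE (x y : oct) :
  oct_polar x y = (\sum_i x i 0 * y i 0) *+ 2.
Proof.
rewrite /oct_polar /oct_norm -!sumrB -sumrMnl; apply: eq_bigr => i _.
by rewrite mxE sqrrD addrAC addrK addrAC subrr add0r.
Qed.

Lemma oct_polar_is_linear (x : oct) :
  linear (fun y : oct => oct_polar x y : F^o).
Proof.
move=> a y z; rewrite !oct_polarE.
rewrite -[a *: (_ : F^o)]/(a * _) mulrnAr -mulrnDl mulr_sumr -big_split.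
congr (_ *+ 2); apply: eq_bigr => i _.
by rewrite !mxE mulrDr mulrCA.
Qed.

Lemma memv_oct_im (x : oct) :
  (x \in oct_im) = (oct_polar oct_one x == 0).
Proof.
pose f : {linear oct -> F^o} := HB.pack (fun y : oct => oct_polar oct_one y : F^o)
  (GRing.isLinear.Build F oct F^o *:%R _ (oct_polar_is_linear oct_one)).
by rewrite memv_ker (lfunE f).
Qed.

Definition oct_subalgebra (A : {vspace oct}) : Prop :=
  oct_one \in A /\ {in A &, forall x y, oct_mul x y \in A}.

(* G_2 = Aut(O), as a group of 8 x 8 matrices acting on column vectors. *)
Definition G2 : set 'M[F]_(cd_dim 3) :=
  [set g | g \in unitmx /\
           forall x y : oct, g *m oct_mul x y = oct_mul (g *m x) (g *m y)].

Definition CG : set {vspace oct} :=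
  [set (A :&: oct_im)%VS | A in
     [set A : {vspace oct} | oct_subalgebra A /\ \dim A = 4%N]].

End Octonions.

Arguments oct_one F : clear implicits.
Arguments oct_im F : clear implicits.
Arguments G2 F : clear implicits.
Arguments CG F : clear implicits.

(** ** Linear algebraic groups in GL_n(F) and tori

   Groups are identified with their sets of F-points, which is adequate only
   over an algebraically closed field. *)

Section AlgebraicGroups.
Variable F : fieldType.

(* The regular functions on GL_n are the polynomials in the entries of a
   matrix g and in 1 / det g. *)
Definition gl_coord n (g : 'M[F]_n) : 'rV[F]_(n * n + 1) :=
  row_mx (mxvec g) (\det g)^-1%:M.

Definition gl_eval n (p : mpoly.mpoly (n * n + 1) F) (g : 'M[F]_n) : F :=
  mpoly.meval (fun k => gl_coord g 0 k) p.

Definition gl_closed n (X : set 'M[F]_n) : Prop :=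
  exists S : set (mpoly.mpoly (n * n + 1) F),
    X = [set g | g \in unitmx /\ forall p, S p -> gl_eval p g = 0].

Definition gl_subgroup n (X : set 'M[F]_n) : Prop :=
  [/\ X `<=` [set g | g \in unitmx],
      X 1%:M,
      (forall g h, X g -> X h -> X (g *m h)) &
      (forall g, X g -> X (invmx g))].

Definition algebraic_group n (X : set 'M[F]_n) : Prop :=
  gl_closed X /\ gl_subgroup X.

Definition algebraic_morphism m n (X : set 'M[F]_m) (Y : set 'M[F]_n)
    (f : 'M[F]_m -> 'M[F]_n) : Prop :=
  [/\ forall g, X g -> Y (f g),
      forall g h, X g -> X h -> f (g *m h) = f g *m f h &
      forall i j, exists p, forall g, X g -> f g i j = gl_eval p g].

Definition algebraic_isomorphic m n (X : set 'M[F]_m) (Y : set 'M[F]_n) :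
    Prop :=
  exists (f : 'M[F]_m -> 'M[F]_n) (f' : 'M[F]_n -> 'M[F]_m),
    [/\ algebraic_morphism X Y f, algebraic_morphism Y X f',
        forall g, X g -> f' (f g) = g & forall h, Y h -> f (f' h) = h].

(* (G_m)^r, as the group of invertible diagonal matrices. *)
Definition diag_torus r : set 'M[F]_r :=
  [set g | g \in unitmx /\ is_diag_mx g].

Definition is_torus n (T : set 'M[F]_n) : Prop :=
  algebraic_group T /\ exists r, algebraic_isomorphic (@diag_torus r) T.

Definition maximal_torus n (G T : set 'M[F]_n) : Prop :=
  [/\ is_torus T, T `<=` G &
      forall S, is_torus S -> S `<=` G -> T `<=` S -> S = T].

Definition gl_fixed n (T : set 'M[F]_n) : set {vspace 'cV[F]_n} :=
  [set W | forall g, T g -> (linfun (mulmx g) @: W)%VS = W].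

End AlgebraicGroups.

(* Main.v *)
From HB Require Import structures.
Require Import Defs.
From mathcomp Require Import all_boot all_order all_algebra.
From mathcomp Require Import classical_sets functions cardinality reals complex.
From mathcomp Require Import separable cyclotomic boolp perm ring.
From mathcomp Require Import mpoly.
Set Implicit Arguments.
Unset Strict Implicit.
Unset Printing Implicit Defensive.
Import GRing.Theory Num.Theory.
Local Open Scope classical_set_scope.
Local Open Scope card_scope.
Local Open Scope ring_scope.

(** Call a basis 1, e, x1, x2, x3, y1, y2, y3 of the octonions split if e is an
    idempotent, e xi = xi = xi (1 - e), (1 - e) yi = yi = yi e, xi yi = e,
    yi xi = 1 - e, x1 x2 = y3 and y1 y2 = - x3 and cyclically, and the products that
    do not follow from these vanish ([split_basis]).  The linear maps that fix 1 and e
    and multiply xi by ai and yi by its inverse, where a1 a2 a3 = 1, are automorphisms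
    and form a torus of rank two ([split_torus_is_torus], [split_torus_G2]).

    Every torus in G2 is contained in such a torus ([torus_sub_split]), so that a
    maximal torus is equal to one.  Indeed a torus is diagonalizable
    ([torus_diagonalizable]).  The polar form pairs a weight with its inverse only, and
    a nontrivial weight differs from its inverse because every element of the torus is a
    square.  So nontrivial weights come in pairs, and the trivial weight has even
    multiplicity, which is positive as 1 is fixed ([card_trivial_weights]).  This gives
    a fixed vector u orthogonal to 1, which can be scaled so that u u = 1
    ([fixed_unit]), and the idempotent e = (1 + u) / 2.  The torus acts on the Peirce
    space of the x with e x = x = x (1 - e), where the map x (y z) with values in the
    line of e is not zero ([peirce_mul_neq0]).  It is therefore nonzero on some weight
    vectors x1, x2, x3 ([weight_frame]), and these together with their products
    y1 = x2 x3, y2 = x3 x1, y3 = x1 x2 complete 1 and e to a split basis, the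
    multiplication table being a consequence of alternativity ([frame_basisP]).

    It remains to count.  A subalgebra and its imaginary part determine each other and
    are stable together.  The torus of a split basis contains an element with seven
    distinct eigenvalues on e, x1, x2, x3, y1, y2, y3, so a stable subspace that
    contains 1 is spanned by 1 and some of these seven vectors
    ([fixed_code_space]).  In dimension four there are three of them, and among the
    35 triples the multiplication table leaves 15 that yield a subalgebra
    ([size_split_codes]): the nine {e, xi, yj} for any i and j, and the six
    {xi, xj, yk} and {yi, yj, xk} for distinct i, j, k. *)

(** * Coordinates of octonions *)

Section Coordinates.
Variable F : fieldType.
Local Notation oct := 'cV[F]_(cd_dim 3).

(** The unit, the product and the polar form of the octonions, locked: comparing
    two of their values up to conversion would otherwise unfold the doublings. *)
Definition oone : oct := locked (oct_one F).
Definition omul : oct -> oct -> oct := locked (@oct_mul F).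
Definition opolar : oct -> oct -> F := locked (@oct_polar F).
Definition otrace (x : oct) : F := opolar oone x.
Local Notation "x ** y" := (omul x y) (at level 40, left associativity).

Local Notation "1o" := oone.

Lemma ooneE : oone = oct_one F.
Proof. by rewrite /oone -lock. Qed.

Lemma opolarE x y : opolar x y = oct_polar x y.
Proof. by rewrite /opolar -lock. Qed.

Lemma omulE x y : omul x y = oct_mul x y.
Proof. by rewrite /omul -lock. Qed.

Lemma cd_mul_col m (a b c d : 'cV[F]_(cd_dim m)) :
  @cd_mul F m.+1 (col_mx a b) (col_mx c d) =
  col_mx (cd_mul a c - cd_mul (cd_conj d) b) (cd_mul d a + cd_mul b (cd_conj c)).
Proof. by rewrite /= !col_mxKu !col_mxKd. Qed.

Lemma cd_conj_col m (a b : 'cV[F]_(cd_dim m)) :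
  @cd_conj F m.+1 (col_mx a b) = col_mx (cd_conj a) (- b).
Proof. by rewrite /= col_mxKu col_mxKd. Qed.

Definition vec1 (a : F) : 'cV[F]_(cd_dim 0) := a%:M.
Definition vec2 a b : 'cV[F]_(cd_dim 1) := col_mx (vec1 a) (vec1 b).
Definition vec4 a b c d : 'cV[F]_(cd_dim 2) := col_mx (vec2 a b) (vec2 c d).
Definition vec8 a b c d a' b' c' d' : oct :=
  col_mx (vec4 a b c d) (vec4 a' b' c' d').

Lemma vec1P x : exists a, x = vec1 a.
Proof. by exists (x 0 0); exact: mx11_scalar. Qed.

Lemma vec2P x : exists a b, x = vec2 a b.
Proof.
have [a Ea] := vec1P (usubmx x); have [b Eb] := vec1P (dsubmx x).
by exists a, b; rewrite /vec2 -Ea -Eb vsubmxK.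
Qed.

Lemma vec4P x : exists a b c d, x = vec4 a b c d.
Proof.
have [a [b E]] := vec2P (usubmx x); have [c [d E']] := vec2P (dsubmx x).
by exists a, b, c, d; rewrite /vec4 -E -E' vsubmxK.
Qed.

Lemma vec8P x : exists a b c d a' b' c' d', x = vec8 a b c d a' b' c' d'.
Proof.
have [a [b [c [d E]]]] := vec4P (usubmx x).
have [a' [b' [c' [d' E']]]] := vec4P (dsubmx x).
by exists a, b, c, d, a', b', c', d'; rewrite /vec8 -E -E' vsubmxK.
Qed.

Lemma add_vec1 a b : vec1 a + vec1 b = vec1 (a + b).
Proof. by rewrite /vec1 raddfD. Qed.
Lemma opp_vec1 a : - vec1 a = vec1 (- a).
Proof. by rewrite /vec1 raddfN. Qed.
Lemma scale_vec1 k a : k *: vec1 a = vec1 (k * a).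
Proof. by rewrite /vec1 scale_scalar_mx. Qed.
Lemma conj_vec1 a : cd_conj (vec1 a) = vec1 a.
Proof. by []. Qed.
Lemma mul_vec1 a b : cd_mul (vec1 a) (vec1 b) = vec1 (a * b).
Proof. by rewrite /= /vec1 -scalar_mxM. Qed.

Lemma add_vec2 a b c d : vec2 a b + vec2 c d = vec2 (a + c) (b + d).
Proof. by rewrite /vec2 add_col_mx !add_vec1. Qed.
Lemma opp_vec2 a b : - vec2 a b = vec2 (- a) (- b).
Proof. by rewrite /vec2 opp_col_mx !opp_vec1. Qed.
Lemma scale_vec2 k a b : k *: vec2 a b = vec2 (k * a) (k * b).
Proof. by rewrite /vec2 scale_col_mx !scale_vec1. Qed.
Lemma conj_vec2 a b : cd_conj (vec2 a b) = vec2 a (- b).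
Proof. by rewrite /vec2 cd_conj_col opp_vec1. Qed.
Lemma mul_vec2 a b c d :
  cd_mul (vec2 a b) (vec2 c d) = vec2 (a * c - d * b) (d * a + b * c).
Proof.
by rewrite /vec2 cd_mul_col !conj_vec1 !mul_vec1 !opp_vec1 !add_vec1.
Qed.

Lemma add_vec4 a b c d a' b' c' d' : vec4 a b c d + vec4 a' b' c' d' =
  vec4 (a + a') (b + b') (c + c') (d + d').
Proof. by rewrite /vec4 add_col_mx !add_vec2. Qed.
Lemma opp_vec4 a b c d : - vec4 a b c d = vec4 (- a) (- b) (- c) (- d).
Proof. by rewrite /vec4 opp_col_mx !opp_vec2. Qed.
Lemma scale_vec4 k a b c d :
  k *: vec4 a b c d = vec4 (k * a) (k * b) (k * c) (k * d).
Proof. by rewrite /vec4 scale_col_mx !scale_vec2. Qed.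
Lemma conj_vec4 a b c d : cd_conj (vec4 a b c d) = vec4 a (- b) (- c) (- d).
Proof. by rewrite /vec4 cd_conj_col conj_vec2 opp_vec2. Qed.
Lemma mul_vec4 a b c d a' b' c' d' :
  cd_mul (vec4 a b c d) (vec4 a' b' c' d') =
  vec4 (a * a' - b * b' - c * c' - d * d')
       (a * b' + b * a' + c * d' - d * c')
       (a * c' - b * d' + c * a' + d * b')
       (a * d' + b * c' - c * b' + d * a').
Proof.
rewrite /vec4 cd_mul_col !conj_vec2 !mul_vec2 !opp_vec2 !add_vec2.
by congr (col_mx (vec2 _ _) (vec2 _ _)); ring.
Qed.

Lemma add_vec8 a b c d e f g h a' b' c' d' e' f' g' h' :
  vec8 a b c d e f g h + vec8 a' b' c' d' e' f' g' h' =
  vec8 (a + a') (b + b') (c + c') (d + d') (e + e') (f + f') (g + g') (h + h').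
Proof. by rewrite /vec8 add_col_mx !add_vec4. Qed.
Lemma opp_vec8 a b c d e f g h : - vec8 a b c d e f g h =
  vec8 (- a) (- b) (- c) (- d) (- e) (- f) (- g) (- h).
Proof. by rewrite /vec8 opp_col_mx !opp_vec4. Qed.
Lemma scale_vec8 k a b c d e f g h : k *: vec8 a b c d e f g h =
  vec8 (k * a) (k * b) (k * c) (k * d) (k * e) (k * f) (k * g) (k * h).
Proof. by rewrite /vec8 scale_col_mx !scale_vec4. Qed.
Lemma omul_vec8 a b c d e f g h a' b' c' d' e' f' g' h' :
  vec8 a b c d e f g h ** vec8 a' b' c' d' e' f' g' h' =
  vec8
   (a * a' - b * b' - c * c' - d * d' - e * e' - f * f' - g * g' - h * h')
   (a * b' + b * a' + c * d' - d * c' + e * f' - f * e' - g * h' + h * g')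
   (a * c' - b * d' + c * a' + d * b' + e * g' + f * h' - g * e' - h * f')
   (a * d' + b * c' - c * b' + d * a' + e * h' - f * g' + g * f' - h * e')
   (a * e' - b * f' - c * g' - d * h' + e * a' + f * b' + g * c' + h * d')
   (a * f' + b * e' - c * h' + d * g' - e * b' + f * a' - g * d' + h * c')
   (a * g' + b * h' + c * e' - d * f' - e * c' + f * d' + g * a' - h * b')
   (a * h' - b * g' + c * f' + d * e' - e * d' - f * c' + g * b' + h * a').
Proof.
rewrite omulE /oct_mul /vec8 cd_mul_col !conj_vec4 !mul_vec4 !opp_vec4 !add_vec4.
by congr (col_mx (vec4 _ _ _ _) (vec4 _ _ _ _)); ring.
Qed.

Lemma oone_vec8 : 1o = vec8 1 0 0 0 0 0 0 0.
Proof.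
rewrite ooneE /vec8 /vec4 /vec2 /vec1 /oct_one /= !raddf0 !col_mx0.
by [].
Qed.

Lemma oct_norm_vec8 a b c d e f g h :
  oct_norm (vec8 a b c d e f g h) =
  a ^+ 2 + b ^+ 2 + c ^+ 2 + d ^+ 2 + e ^+ 2 + f ^+ 2 + g ^+ 2 + h ^+ 2.
Proof.
have sq m (x y : 'cV[F]_m) : \sum_i col_mx x y i 0 ^+ 2 =
    \sum_i x i 0 ^+ 2 + \sum_i y i 0 ^+ 2.
  rewrite big_split_ord; congr (_ + _); apply: eq_bigr => i _.
    by rewrite col_mxEu.
  by rewrite col_mxEd.
have sq1 x : \sum_i vec1 x i 0 ^+ 2 = x ^+ 2 by rewrite big_ord1 mxE mulr1n.
have sq2 x y : \sum_i vec2 x y i 0 ^+ 2 = x ^+ 2 + y ^+ 2.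
  by rewrite -[x ^+ 2]sq1 -[y ^+ 2]sq1; exact: sq.
have sq4 x y z t : \sum_i vec4 x y z t i 0 ^+ 2 =
    (x ^+ 2 + y ^+ 2) + (z ^+ 2 + t ^+ 2).
  by rewrite -sq2 -sq2; exact: sq.
transitivity (a ^+ 2 + b ^+ 2 + (c ^+ 2 + d ^+ 2) +
              (e ^+ 2 + f ^+ 2 + (g ^+ 2 + h ^+ 2))); last by ring.
by rewrite -!sq4; exact: sq.
Qed.

Lemma omulDl (x y z : oct) : (x + y) ** z = x ** z + y ** z.
Proof.
have [? [? [? [? [? [? [? [? ->]]]]]]]] := vec8P x.
have [? [? [? [? [? [? [? [? ->]]]]]]]] := vec8P y.
have [? [? [? [? [? [? [? [? ->]]]]]]]] := vec8P z.
rewrite !(add_vec8, omul_vec8); congr vec8; ring.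
Qed.

Lemma omulDr (x y z : oct) : x ** (y + z) = x ** y + x ** z.
Proof.
have [? [? [? [? [? [? [? [? ->]]]]]]]] := vec8P x.
have [? [? [? [? [? [? [? [? ->]]]]]]]] := vec8P y.
have [? [? [? [? [? [? [? [? ->]]]]]]]] := vec8P z.
rewrite !(add_vec8, omul_vec8); congr vec8; ring.
Qed.

Lemma omulZl k (x y : oct) : (k *: x) ** y = k *: (x ** y).
Proof.
have [? [? [? [? [? [? [? [? ->]]]]]]]] := vec8P x.
have [? [? [? [? [? [? [? [? ->]]]]]]]] := vec8P y.
rewrite !(scale_vec8, omul_vec8); congr vec8; ring.
Qed.

Lemma omulZr k (x y : oct) : x ** (k *: y) = k *: (x ** y).
Proof.
have [? [? [? [? [? [? [? [? ->]]]]]]]] := vec8P x.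
have [? [? [? [? [? [? [? [? ->]]]]]]]] := vec8P y.
rewrite !(scale_vec8, omul_vec8); congr vec8; ring.
Qed.

Lemma omul1 (x : oct) : 1o ** x = x.
Proof.
have [? [? [? [? [? [? [? [? ->]]]]]]]] := vec8P x.
rewrite oone_vec8 omul_vec8; congr vec8; ring.
Qed.

Lemma omulr1 (x : oct) : x ** 1o = x.
Proof.
have [? [? [? [? [? [? [? [? ->]]]]]]]] := vec8P x.
rewrite oone_vec8 omul_vec8; congr vec8; ring.
Qed.

Lemma otrace_vec8 a b c d e f g h :
  otrace (vec8 a b c d e f g h) = a *+ 2.
Proof.
by rewrite /otrace opolarE /oct_polar oone_vec8 add_vec8 !oct_norm_vec8; ring.
Qed.

(** Left alternativity together with the quadratic equation of [x].  Besides
    bilinearity and the unit laws, this identity, its mirror image [omulKr] and the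
    trace formulas [otrace_mul] and [opolar_mul] are all that is computed in
    coordinates: they determine the multiplication table of a split basis. *)
Lemma omulKl (x y : oct) :
  x ** (x ** y) = otrace x *: (x ** y) - oct_norm x *: y.
Proof.
have [? [? [? [? [? [? [? [? ->]]]]]]]] := vec8P x.
have [? [? [? [? [? [? [? [? ->]]]]]]]] := vec8P y.
rewrite oct_norm_vec8 otrace_vec8.
rewrite !(omul_vec8, scale_vec8, opp_vec8, add_vec8); congr vec8; ring.
Qed.

Lemma omulKr (x y : oct) :
  (y ** x) ** x = otrace x *: (y ** x) - oct_norm x *: y.
Proof.
have [? [? [? [? [? [? [? [? ->]]]]]]]] := vec8P x.
have [? [? [? [? [? [? [? [? ->]]]]]]]] := vec8P y.
rewrite oct_norm_vec8 otrace_vec8.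
rewrite !(omul_vec8, scale_vec8, opp_vec8, add_vec8); congr vec8; ring.
Qed.
End Coordinates.

Local Notation "x ** y" := (omul x y) (at level 40, left associativity).

(** Proves identities between linear combinations entrywise.  Products are abstracted
    first, so that [mxE] leaves them alone. *)
Ltac vec_ring :=
  repeat match goal with
  | |- context [omul ?x ?y] =>
      let z := fresh "z" in generalize (omul x y); intro z
  end;
  apply/matrixP=> i j; rewrite !mxE; ring.

(** * Octonions as a composition algebra *)

Section CompositionAlgebra.
Variable F : fieldType.
Local Notation oct := 'cV[F]_(cd_dim 3).
Local Notation "1o" := (oone F).
Implicit Types x y z : oct.

Lemma opolarC x y : opolar x y = opolar y x.
Proof. by rewrite !opolarE !oct_polarE; under eq_bigr do rewrite mulrC. Qed.

Lemma opolarDr x y z : opolar x (y + z) = opolar x y + opolar x z.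
Proof.
rewrite !opolarE !oct_polarE -mulrnDl -big_split; congr (_ *+ 2).
by apply: eq_bigr => i _; rewrite mxE mulrDr.
Qed.

Lemma opolarZr k x y : opolar x (k *: y) = k * opolar x y.
Proof.
rewrite !opolarE !oct_polarE mulrnAr mulr_sumr; congr (_ *+ 2).
by apply: eq_bigr => i _; rewrite !mxE mulrCA.
Qed.

Lemma opolarZl k x y : opolar (k *: x) y = k * opolar x y.
Proof. by rewrite opolarC opolarZr opolarC. Qed.

Lemma opolarNr x y : opolar x (- y) = - opolar x y.
Proof. by rewrite -scaleN1r opolarZr mulN1r. Qed.

Lemma opolarNl x y : opolar (- x) y = - opolar x y.
Proof. by rewrite opolarC opolarNr opolarC. Qed.

Lemma opolar0r x : opolar x 0 = 0.
Proof. by rewrite -(scale0r 0) opolarZr mul0r. Qed.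

Lemma opolar_sumr (I : Type) (r : seq I) (f : I -> oct) x :
  opolar x (\sum_(i <- r) f i) = \sum_(i <- r) opolar x (f i).
Proof.
by apply: (big_morph (opolar x) (opolarDr x) (opolar0r x)).
Qed.

Lemma oct_normD x y : oct_norm (x + y) = oct_norm x + oct_norm y + opolar x y.
Proof. by rewrite opolarE /oct_polar; ring. Qed.

Lemma oct_normZ k x : oct_norm (k *: x) = k ^+ 2 * oct_norm x.
Proof.
by rewrite /oct_norm mulr_sumr; apply: eq_bigr => i _; rewrite mxE exprMn.
Qed.

Lemma opolarxx x : opolar x x = oct_norm x *+ 2.
Proof. by rewrite opolarE oct_polarE. Qed.

Lemma otraceD x y : otrace (x + y) = otrace x + otrace y.
Proof. exact: opolarDr. Qed.

Lemma otraceZ k x : otrace (k *: x) = k * otrace x.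
Proof. exact: opolarZr. Qed.

Lemma otraceN x : otrace (- x) = - otrace x.
Proof. exact: opolarNr. Qed.

Lemma otrace1 : otrace 1o = 2.
Proof. by rewrite oone_vec8 otrace_vec8. Qed.

Lemma omul0l x : 0 ** x = 0.
Proof. by rewrite -(scale0r 0) omulZl !scale0r. Qed.

Lemma omul0r x : x ** 0 = 0.
Proof. by rewrite -(scale0r 0) omulZr !scale0r. Qed.

Lemma omulNl x y : (- x) ** y = - (x ** y).
Proof. by rewrite -scaleN1r omulZl scaleN1r. Qed.

Lemma omulNr x y : x ** (- y) = - (x ** y).
Proof. by rewrite -scaleN1r omulZr scaleN1r. Qed.

Lemma omul_suml (I : Type) (r : seq I) (f : I -> oct) x :
  (\sum_(i <- r) f i) ** x = \sum_(i <- r) f i ** x.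
Proof.
exact: (big_morph (fun y => y ** x) (fun y z => omulDl y z x) (omul0l x)).
Qed.

Lemma omul_sumr (I : Type) (r : seq I) (f : I -> oct) x :
  x ** (\sum_(i <- r) f i) = \sum_(i <- r) x ** f i.
Proof. exact: (big_morph (omul x) (omulDr x) (omul0r x)). Qed.

Lemma otrace_mul x y :
  otrace (x ** y) = otrace x * otrace y - opolar x y.
Proof.
have [? [? [? [? [? [? [? [? ->]]]]]]]] := vec8P x.
have [? [? [? [? [? [? [? [? ->]]]]]]]] := vec8P y.
by rewrite omul_vec8 !otrace_vec8 opolarE /oct_polar add_vec8 !oct_norm_vec8; ring.
Qed.

Lemma opolar_mul x y : opolar x (x ** y) = oct_norm x * otrace y.
Proof.
have [? [? [? [? [? [? [? [? ->]]]]]]]] := vec8P x.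
have [? [? [? [? [? [? [? [? ->]]]]]]]] := vec8P y.
rewrite opolarE /oct_polar omul_vec8 !otrace_vec8 add_vec8 !oct_norm_vec8; ring.
Qed.

Lemma oct_sqr x : x ** x = otrace x *: x - oct_norm x *: 1o.
Proof. by have := omulKl x 1o; rewrite omulr1. Qed.

(** Polarization of [omulKl].  For [x] and [y] orthogonal to 1 and to each other it
    says that left multiplications by [x] and [y] anticommute. *)
Lemma omulKl2 x y z : x ** (y ** z) + y ** (x ** z) =
  otrace x *: (y ** z) + otrace y *: (x ** z) - opolar x y *: z.
Proof.
transitivity ((x + y) ** ((x + y) ** z) - x ** (x ** z) - y ** (y ** z)).
  by rewrite !(omulDl, omulDr); vec_ring.
by rewrite !omulKl oct_normD otraceD !omulDl; vec_ring.
Qed.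

Lemma omulKr2 x y z : (z ** x) ** y + (z ** y) ** x =
  otrace x *: (z ** y) + otrace y *: (z ** x) - opolar x y *: z.
Proof.
transitivity ((z ** (x + y)) ** (x + y) - (z ** x) ** x - (z ** y) ** y).
  by rewrite !(omulDl, omulDr); vec_ring.
by rewrite !omulKr oct_normD otraceD !omulDr; vec_ring.
Qed.

Lemma omulC x y : x ** y + y ** x =
  otrace x *: y + otrace y *: x - opolar x y *: 1o.
Proof. by have := omulKl2 x y 1o; rewrite !omulr1. Qed.

End CompositionAlgebra.

(** * Peirce spaces of an imaginary octonion of square one *)

Section Geometry.
Variable F : numFieldType.
Local Notation oct := 'cV[F]_(cd_dim 3).
Local Notation "1o" := (oone F).
Implicit Types x y z : oct.

Lemma two_neq0 : 2 != 0 :> F. Proof. by rewrite pnatr_eq0. Qed.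

Lemma opolar_nondeg x : (forall y, opolar x y = 0) -> x = 0.
Proof.
move=> x0; apply/matrixP => i j; rewrite ord1 [RHS]mxE.
have /eqP := x0 (delta_mx i 0).
rewrite opolarE oct_polarE (bigD1 i) //= big1 => [|k ki].
  by rewrite mxE !eqxx mulr1 addr0 mulrn_eq0 /= => /eqP.
by rewrite mxE (negPf ki) mulr0.
Qed.

Section Peirce.
Variable u : oct.
Hypotheses (tu : otrace u = 0) (qu : oct_norm u = -1).

Lemma oct_unitK x : u ** (u ** x) = x.
Proof. by rewrite omulKl tu qu; vec_ring. Qed.

Lemma oct_unit_sqr : u ** u = 1o.
Proof. by rewrite oct_sqr tu qu; vec_ring. Qed.

Lemma opolar_unit : opolar u u = -2.
Proof. by rewrite opolarxx qu; ring. Qed.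

(** With e = (1 + u) / 2, which is an idempotent as u u = 1, this is the Peirce space
    of the x with e x = x = x (1 - e).  The opposite Peirce space is [peirce (- u)],
    so every statement about one of them yields one about the other. *)
Definition peirce x := [/\ otrace x = 0, opolar u x = 0 & u ** x = x].

Lemma peirce_mulr x : peirce x -> x ** u = - x.
Proof.
move=> [tx ux Ex]; have := omulC u x; rewrite tu tx ux Ex.
by rewrite !scale0r subr0 add0r => /eqP; rewrite addrC addr_eq0 => /eqP.
Qed.

Lemma peirceZ k x : peirce x -> peirce (k *: x).
Proof.
move=> [tx ux Ex]; split; rewrite ?otraceZ ?opolarZr ?omulZr ?tx ?ux ?Ex //.
  by rewrite mulr0.
by rewrite mulr0.
Qed.

Lemma peirceD x y : peirce x -> peirce y -> peirce (x + y).
Proof.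
move=> [tx ux Ex] [ty uy Ey].
by split; rewrite ?otraceD ?opolarDr ?omulDr ?tx ?ux ?ty ?uy ?Ex ?Ey ?addr0.
Qed.

Lemma anticomm_mull x z : otrace x = 0 -> opolar u x = 0 ->
  u ** (x ** z) = - (x ** (u ** z)).
Proof.
move=> tx ux; have := omulKl2 u x z; rewrite tu tx ux.
by rewrite !scale0r subr0 addr0 => /eqP; rewrite addr_eq0 => /eqP.
Qed.

Lemma anticomm_mulr x z : otrace x = 0 -> opolar u x = 0 ->
  (z ** x) ** u = - ((z ** u) ** x).
Proof.
move=> tx ux; have := omulKr2 u x z; rewrite tu tx ux.
by rewrite !scale0r subr0 addr0 => /eqP; rewrite addrC addr_eq0 => /eqP.
Qed.

(** Left multiplication by [u] anticommutes with that by [x], so that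
    u (x x) = - x x, whereas x x = - q(x) 1 is a scalar. *)
Lemma peirce_norm x : peirce x -> oct_norm x = 0.
Proof.
move=> [tx ux Ex].
have := anticomm_mull x tx ux; rewrite Ex oct_sqr tx scale0r sub0r.
rewrite omulNr omulZr omulr1 opprK => E.
have := congr1 (@otrace F) E; rewrite otraceN !otraceZ tu mulr0 oppr0.
by rewrite otrace1 => /esym/eqP; rewrite mulf_eq0 (negPf two_neq0) orbF => /eqP.
Qed.

Lemma peirce_polar x y : peirce x -> peirce y -> opolar x y = 0.
Proof.
move=> Vx Vy; have := peirce_norm (peirceD Vx Vy).
by rewrite oct_normD !peirce_norm // !add0r.
Qed.

Lemma peirce_anticomm x y : peirce x -> peirce y -> x ** y = - (y ** x).
Proof.
move=> Vx Vy; have := omulC x y; rewrite (peirce_polar Vx Vy).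
case: Vx Vy => -> _ _ [-> _ _]; rewrite !scale0r subr0 addr0.
by move/eqP; rewrite addr_eq0 => /eqP.
Qed.

Definition peirce_idem : oct := 2^-1 *: (1o + u).

(** Removing from [x] its components along 1 and [u] leaves a vector y with
    u y = - y u, and the projection of y is (y + u y) / 2.  The formula below is the
    expanded form, which is visibly linear in [x]. *)
Definition peirce_proj x : oct :=
  2^-1 *: (x + u ** x) - (4^-1 * (otrace x - opolar u x)) *: (1o + u).

Lemma peirce_proj_linear : linear peirce_proj.
Proof.
move=> k x y; rewrite /peirce_proj omulDr omulZr otraceD otraceZ.
by rewrite opolarDr opolarZr; vec_ring.
Qed.

Lemma opolaru1 : opolar u 1o = 0. Proof. by rewrite opolarC. Qed.

Lemma peirce_projP x : peirce (peirce_proj x).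
Proof.
have F4 : 4 != 0 :> F by rewrite pnatr_eq0.
have F2 := two_neq0.
rewrite /peirce_proj; split.
- rewrite otraceD otraceN !otraceZ !otraceD otrace_mul tu otrace1.
  by field.
- rewrite opolarDr opolarNr !opolarZr !opolarDr opolar_mul qu.
  by rewrite opolaru1 opolar_unit; field.
rewrite omulDr omulNr !omulZr !omulDr oct_unitK oct_unit_sqr omulr1.
by vec_ring.
Qed.

End Peirce.
Definition im_part x : oct := x - (otrace x / 2) *: 1o.

Lemma im_partK x : im_part x + (otrace x / 2) *: 1o = x.
Proof. exact: subrK. Qed.

Lemma otrace_im_part x : otrace (im_part x) = 0.
Proof.
by rewrite /im_part otraceD otraceN otraceZ otrace1 divfK ?subrr ?two_neq0.
Qed.
End Geometry.

Section SplitTriples.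
Variable F : numFieldType.
Local Notation oct := 'cV[F]_(cd_dim 3).
Local Notation "1o" := (oone F).
Implicit Types u x y z w : oct.

Lemma scaler_half (V : lmodType F) (x : V) : 2^-1 *: (x + x) = x.
Proof.
rewrite -mulr2n -[x *+ 2]scaler_nat scalerA mulVf ?two_neq0 //.
exact: scale1r.
Qed.

Lemma peirce_proj_id u x : peirce u x -> peirce_proj u x = x.
Proof.
by move=> [tx ux Ex]; rewrite /peirce_proj tx ux Ex subrr mulr0 scale0r subr0
  scaler_half.
Qed.

(** Moving [u] past [x], with which it anticommutes, gives
    u (x y) = - x (u y) = - x y. *)
Lemma peirce_mul u x y : otrace u = 0 -> peirce u x -> peirce u y ->
  peirce (- u) (x ** y).
Proof.
move=> tu Vx Vy; have [tx ux Ex] := Vx; have [ty uy Ey] := Vy.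
have Exy : u ** (x ** y) = - (x ** y) by rewrite (anticomm_mull tu) // Ey.
have txy : otrace (x ** y) = 0.
  by rewrite otrace_mul tx ty (peirce_polar tu) // mulr0 subr0.
split=> //; last by rewrite omulNl Exy opprK.
have := otrace_mul u (x ** y); rewrite Exy otraceN txy mulr0 sub0r opolarNl.
by rewrite oppr0.
Qed.

Section Unit.
Variable u : oct.
Hypotheses (tu : otrace u = 0) (qu : oct_norm u = -1).

Lemma otrace_opp0 : otrace (- u) = 0. Proof. by rewrite otraceN tu oppr0. Qed.

Lemma oct_norm_oppN1 : oct_norm (- u) = -1.
Proof. by rewrite -scaleN1r oct_normZ sqrrN expr1n mul1r. Qed.

(** The product z commutes with [u] and u z = z.  Then 2 z = u z + z u is a combination
    of 1 and [u], hence a multiple of the idempotent, which its trace determines. *)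
Lemma peirce_mul_opp x w : peirce u x -> peirce (- u) w ->
  x ** w = - opolar x w *: peirce_idem u.
Proof.
move=> Vx Ww; have [tx ux Ex] := Vx; have [tw uw' Ew'] := Ww.
have uw : opolar u w = 0.
  by apply/eqP; rewrite -oppr_eq0 -opolarNl uw'.
have Ew : u ** w = - w by rewrite -[in RHS]Ew' omulNl opprK.
have Ez : u ** (x ** w) = x ** w by rewrite (anticomm_mull tu) // Ew omulNr opprK.
have Ez' : (x ** w) ** u = x ** w.
  by rewrite (anticomm_mulr tu) // (peirce_mulr tu) // omulNl opprK.
have tz : otrace (x ** w) = - opolar x w.
  by rewrite otrace_mul tx mul0r sub0r.
have uz : opolar u (x ** w) = - otrace (x ** w).
  by rewrite -[in RHS]Ez [in RHS]otrace_mul tu mul0r sub0r opprK.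
have E := omulC u (x ** w); rewrite Ez Ez' tu scale0r add0r uz tz in E.
rewrite -[LHS]scaler_half E /peirce_idem scalerA mulrC -scalerA.
by congr (_ *: _); vec_ring.
Qed.

Lemma peirce_decomp z : z = 2^-1 *: (otrace z *: 1o) -
  2^-1 *: (opolar u z *: u) + peirce_proj u z + peirce_proj (- u) z.
Proof.
rewrite /peirce_proj opolarNl omulNl.
have F4 : 4 != 0 :> F by rewrite pnatr_eq0.
have F2 := two_neq0 F.
generalize (u ** z) => uz; apply/matrixP => i j; rewrite !mxE; by field.
Qed.

(** The polar form pairs the two Peirce spaces perfectly: each of them is totally
    isotropic and orthogonal to 1 and [u], and they span everything with 1 and [u]. *)
Lemma peirce_opp_eq0 w : peirce (- u) w ->
  (forall x, peirce u x -> opolar x w = 0) -> w = 0.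
Proof.
move=> Ww w0; have [tw uw' _] := Ww.
have wu : opolar w u = 0.
  by apply/eqP; rewrite opolarC -oppr_eq0 -opolarNl uw'.
have w1 : opolar w (oone F) = 0 by rewrite opolarC.
apply: opolar_nondeg => z; rewrite [z]peirce_decomp.
have Vp := peirce_projP tu qu z; have Wp := peirce_projP otrace_opp0 oct_norm_oppN1 z.
move: (peirce_proj u z) (peirce_proj (- u) z) Vp Wp => x y Vx Wy.
rewrite !opolarDr !opolarNr !opolarZr w1 wu (opolarC w x) w0 //.
by rewrite (peirce_polar otrace_opp0 Ww Wy) !mulr0 subrr !addr0.
Qed.

Lemma omul_idemr_opp x : peirce u x -> x ** peirce_idem (- u) = x.
Proof.
move=> Vx; rewrite /peirce_idem omulZr omulDr omulNr (peirce_mulr tu Vx) opprK.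
by rewrite omulr1 scaler_half.
Qed.
End Unit.

Lemma peirce_eq0 u v : otrace u = 0 -> oct_norm u = -1 -> peirce u v ->
  (forall x, peirce (- u) x -> opolar x v = 0) -> v = 0.
Proof.
move=> tu qu Vv v0; apply: (@peirce_opp_eq0 (- u)) => //; last by rewrite opprK.
  exact: otrace_opp0.
exact: oct_norm_oppN1.
Qed.

(** If all products vanished, then v (w y) + w (v y) = - <v, w> y would make every
    [y] in the Peirce space a multiple of [v] as soon as <v, w> is nonzero.  Both
    Peirce spaces would be at most lines, leaving room for dimension four only. *)
Lemma peirce_mul_neq0 u : otrace u = 0 -> oct_norm u = -1 ->
  exists x y, [/\ peirce u x, peirce u y & x ** y != 0].
Proof.
move=> tu qu.
have tNu := otrace_opp0 tu; have qNu := oct_norm_oppN1 qu.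
case: (pselect (exists x y, [/\ peirce u x, peirce u y & x ** y != 0])) => // H.
have {}H x y : peirce u x -> peirce u y -> x ** y = 0.
  by move=> Vx Vy; apply/eqP/negPn/negP => n0; apply: H; exists x, y.
have [v [w [Vline Wline]]] : exists v w,
   (forall x, peirce u x -> exists k, x = k *: v) /\
   (forall x, peirce (- u) x -> exists k, x = k *: w).
  case: (pselect (exists v w, [/\ peirce u v, peirce (- u) w & opolar v w != 0])).
    move=> [v [w [Vv Ww c0]]].
    have Vline x : peirce u x -> exists k, x = k *: v.
      move=> Vx; exists (opolar w x / opolar v w).
      have := omulKl2 v w x; rewrite (H v x) // omul0r addr0.
      have -> : w ** x = - opolar w x *: peirce_idem (- u).
        by apply: peirce_mul_opp => //; rewrite opprK.
      rewrite omulZr (omul_idemr_opp tu Vv).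
      have [-> _ _] := Vv; have [-> _ _] := Ww.
      rewrite !scale0r add0r sub0r scaleNr => /oppr_inj E.
      by rewrite mulrC -scalerA E scalerA mulVf // scale1r.
    exists v, w; split=> // x Wx; exists (opolar v x / opolar v w).
    apply/eqP; rewrite -subr_eq0; apply/eqP; apply: (peirce_opp_eq0 tu qu).
      by rewrite -scaleNr; apply: peirceD => //; apply: peirceZ.
    move=> z /Vline [k ->]; rewrite opolarZl opolarDr opolarNr opolarZr.
    by rewrite mulfVK // subrr mulr0.
  (* No pair is non-orthogonal, so both Peirce spaces are zero. *)
  move=> N; exists 0, 0; split=> x Vx; exists 0; rewrite scaler0.
    apply: (peirce_eq0 tu qu Vx) => y Wy; apply/eqP/negPn/negP => n0.
    by apply: N; exists x, y; rewrite opolarC.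
  apply: (peirce_opp_eq0 tu qu Vx) => y Wy; apply/eqP/negPn/negP => n0.
  by apply: N; exists y, x.
have : (fullv <= <<[:: 1o; u; v; w]>>)%VS.
  apply/subvP => z _; rewrite [z](peirce_decomp u).
  have [k ->] := Vline _ (peirce_projP tu qu z).
  have [l ->] := Wline _ (peirce_projP tNu qNu z).
  by rewrite !(memvD, memvN, memvZ) // memv_span // !inE eqxx ?orbT.
move/dimvS; rewrite dimvf /dim /= => h.
by have := leq_trans h (dim_span [:: 1o; u; v; w]).
Qed.
End SplitTriples.

(** * Split bases *)

Section SplitFrames.
Variable F : numFieldType.
Local Notation oct := 'cV[F]_(cd_dim 3).
Local Notation "1o" := (oone F).
Implicit Types u x y z w : oct.

Lemma peirce_idemDopp u : peirce_idem (- u) = 1o - peirce_idem u.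
Proof.
have F2 := two_neq0 F.
by rewrite /peirce_idem; apply/matrixP => i j; rewrite !mxE; field.
Qed.

Section PeirceUnit.
Variable u : oct.
Hypotheses (tu : otrace u = 0) (qu : oct_norm u = -1).

Lemma omul_idem_sqr : peirce_idem u ** peirce_idem u = peirce_idem u.
Proof.
rewrite /peirce_idem !(omulZl, omulZr) omulDl omul1 omulDr (oct_unit_sqr tu qu).
by rewrite omulr1 [u + _]addrC scaler_half.
Qed.

Lemma omul_ideml x : peirce u x -> peirce_idem u ** x = x.
Proof.
by move=> [_ _ Ex]; rewrite /peirce_idem omulZl omulDl omul1 Ex scaler_half.
Qed.

Lemma omul_idemr x : peirce u x -> x ** peirce_idem u = 0.
Proof.
move=> Vx; rewrite /peirce_idem omulZr omulDr omulr1 (peirce_mulr tu Vx) subrr.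
exact: scaler0.
Qed.

Lemma peirce_idem_trace : otrace (peirce_idem u) = 1.
Proof.
rewrite /peirce_idem otraceZ otraceD tu otrace1 addr0 mulVf //.
exact: two_neq0.
Qed.

Lemma peirce_mulKl x y : peirce u x -> x ** (x ** y) = 0.
Proof.
move=> Vx; rewrite omulKl (peirce_norm tu Vx); case: Vx => -> _ _.
by rewrite !scale0r subr0.
Qed.

Lemma peirce_mulKr x y : peirce u x -> (y ** x) ** x = 0.
Proof.
move=> Vx; rewrite omulKr (peirce_norm tu Vx); case: Vx => -> _ _.
by rewrite !scale0r subr0.
Qed.

Lemma peirce_sqr x : peirce u x -> x ** x = 0.
Proof.
move=> Vx; rewrite oct_sqr (peirce_norm tu Vx); case: Vx => -> _ _.
by rewrite !scale0r subr0.
Qed.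

Lemma peirce_swap x y z : peirce u x -> peirce u y ->
  x ** (y ** z) = - (y ** (x ** z)).
Proof.
move=> Vx Vy; have := omulKl2 x y z; rewrite (peirce_polar tu Vx Vy).
case: Vx Vy => -> _ _ [-> _ _]; rewrite !scale0r subr0 addr0.
by move/eqP; rewrite addr_eq0 => /eqP.
Qed.
End PeirceUnit.

(** Normalized triples in a Peirce space.  Together with [u] they generate the
    octonions, and the condition is invariant under cyclic rotation
    ([split_frame_rot]), so that only a third of the table below has to be derived. *)
Definition split_frame u x y z :=
  [/\ otrace u = 0, oct_norm u = -1,
      [/\ peirce u x, peirce u y & peirce u z] &
      x ** (y ** z) = peirce_idem u].

Lemma split_frame_rot u x y z : split_frame u x y z -> split_frame u y z x.
Proof.
move=> [tu qu [Vx Vy Vz] E]; split=> //.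
by rewrite (peirce_anticomm tu Vz Vx) omulNr -(peirce_swap tu _ Vx Vy).
Qed.

Section FrameProducts.
Variables u x y z : oct.
Hypothesis frame : split_frame u x y z.

(** The products of [x] and [y ** z] in the two orders are the same multiple of the
    idempotent and of the opposite idempotent, by [peirce_mul_opp]. *)
Lemma frame_idem_opp : (y ** z) ** x = 1o - peirce_idem u.
Proof.
have [tu qu [Vx Vy Vz] E] := frame.
have tNu := otrace_opp0 tu; have qNu := oct_norm_oppN1 qu.
have Vx' : peirce (- - u) x by rewrite opprK.
have Wyz := peirce_mul tu Vy Vz.
have := congr1 (@otrace F) E; rewrite (peirce_mul_opp tu Vx Wyz).
rewrite otraceZ peirce_idem_trace // mulr1 => P1.
by rewrite (peirce_mul_opp tNu Wyz Vx') opolarC P1 scale1r peirce_idemDopp.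
Qed.

Lemma frame_mul0 : [/\ x ** (z ** x) = 0, x ** (x ** y) = 0,
  (z ** x) ** x = 0 & (x ** y) ** x = 0].
Proof.
have [tu qu [Vx Vy Vz] E] := frame; split.
- by rewrite (peirce_anticomm tu Vz Vx) omulNr (peirce_mulKl _ _ Vx) // oppr0.
- exact: (peirce_mulKl tu _ Vx).
- exact: (peirce_mulKr tu _ Vx).
by rewrite (peirce_anticomm tu Vx Vy) omulNl (peirce_mulKr _ _ Vx) // oppr0.
Qed.
End FrameProducts.

(** Moving [y ** z] past [z] in (y z) (z x) gives - z ((y z) x), and (y z) x is the
    opposite idempotent 1 - e, for which z (1 - e) = z. *)
Lemma frame_mul_opp u x y z : split_frame u x y z ->
  (y ** z) ** (z ** x) = - z /\ (z ** x) ** (y ** z) = z.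
Proof.
move=> fr; have [tu qu [Vx Vy Vz] E] := fr.
have tNu := otrace_opp0 tu; have qNu := oct_norm_oppN1 qu.
have Wyz := peirce_mul tu Vy Vz; have Wzx := peirce_mul tu Vz Vx.
have [Z _ _ _] := frame_mul0 (split_frame_rot (split_frame_rot fr)).
have P0 : opolar (y ** z) z = 0.
  have := otrace_mul z (y ** z); rewrite Z opolarC; case: Vz => -> _ _.
  by rewrite mul0r sub0r [LHS]opolar0r => /esym/eqP; rewrite oppr_eq0 => /eqP.
have E' : (y ** z) ** (z ** x) = - z.
  have := omulKl2 (y ** z) z x; rewrite P0 (frame_idem_opp fr).
  rewrite omulDr omulr1 omulNr (omul_idemr tu Vz).
  case: Wyz Vz => -> _ _ [-> _ _]; rewrite !scale0r !subr0 addr0.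
  by move/eqP; rewrite addr_eq0 => /eqP.
by split=> //; rewrite (peirce_anticomm tNu Wzx Wyz) E' opprK.
Qed.

(** Entry (i, j) lists the terms of b i ** b j as pairs of a sign bit and an index.
    The index 0 stands for the unit, 1 for the idempotent, 2, 3, 4 for the frame, and
    5, 6, 7 for the dual basis of the opposite Peirce space.  The table is data, so
    that closure under multiplication can be decided by computation. *)
Definition split_table : seq (seq (seq (bool * nat))) :=
  let: (p, n) := (fun k => [:: (false, k)], fun k => [:: (true, k)]) in
  [:: [:: p 0; p 1; p 2; p 3; p 4; p 5; p 6; p 7];
      [:: p 1; p 1; p 2; p 3; p 4; [::]; [::]; [::]];
      [:: p 2; [::]; [::]; p 7; n 6; p 1; [::]; [::]];
      [:: p 3; [::]; n 7; [::]; p 5; [::]; p 1; [::]];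
      [:: p 4; [::]; p 6; n 5; [::]; [::]; [::]; p 1];
      [:: p 5; p 5; [:: (false, 0); (true, 1)]; [::]; [::]; [::]; n 4; p 3];
      [:: p 6; p 6; [::]; [:: (false, 0); (true, 1)]; [::]; p 4; [::]; n 2];
      [:: p 7; p 7; [::]; [::]; [:: (false, 0); (true, 1)]; n 3; p 2; [::]]]%N.

Definition split_mul i j := nth [::] (nth [::] split_table i) j.

Definition split_basis (b : nat -> oct) :=
  [/\ b 0%N = 1o, otrace (b 1%N) = 1,
      forall k, (1 < k < 8)%N -> otrace (b k) = 0 &
      forall i j, (i < 8)%N -> (j < 8)%N ->
        b i ** b j = \sum_(p <- split_mul i j) (-1) ^+ p.1 *: b p.2].

Definition frame_basis u x y z : nat -> oct :=
  nth 0 [:: 1o; peirce_idem u; x; y; z; y ** z; z ** x; x ** y].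

Lemma frame_basisP u x y z :
  split_frame u x y z -> split_basis (frame_basis u x y z).
Proof.
move=> fr; have fr2 := split_frame_rot fr; have fr3 := split_frame_rot fr2.
have [tu qu [Vx Vy Vz] E] := fr; have [_ _ _ E2] := fr2; have [_ _ _ E3] := fr3.
have tNu := otrace_opp0 tu; have qNu := oct_norm_oppN1 qu.
have Wyz := peirce_mul tu Vy Vz; have Wzx := peirce_mul tu Vz Vx.
have Wxy := peirce_mul tu Vx Vy.
have Ie w : peirce (- u) w -> w ** peirce_idem u = w.
  move=> Ww; rewrite -[X in peirce_idem X]opprK.
  by apply: (omul_idemr_opp tNu).
have eI w : peirce (- u) w -> peirce_idem u ** w = 0.
  move=> Ww; have := omul_ideml Ww.
  rewrite peirce_idemDopp omulDl omul1 omulNl -[in RHS](addr0 w).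
  by move/addrI/eqP; rewrite oppr_eq0 => /eqP.
have [x2 x3 x2' x3'] := frame_mul0 fr.
have [y2 y3 y2' y3'] := frame_mul0 fr2.
have [z2 z3 z2' z3'] := frame_mul0 fr3.
have [w12 w21] := frame_mul_opp fr.
have [w23 w32] := frame_mul_opp fr2.
have [w31 w13] := frame_mul_opp fr3.
have yx := peirce_anticomm tu Vy Vx; have zy := peirce_anticomm tu Vz Vy.
have xz := peirce_anticomm tu Vx Vz.
split=> //.
- exact: peirce_idem_trace.
- move=> [|[|[|[|[|[|[|[|]]]]]]]] //= _; rewrite /frame_basis /=.
  + by case: Vx. + by case: Vy. + by case: Vz.
  + by case: Wyz. + by case: Wzx. + by case: Wxy.
have mulI := (omul_idem_sqr tu qu, omul_ideml Vx, omul_ideml Vy, omul_ideml Vz,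
  omul_idemr tu Vx, omul_idemr tu Vy, omul_idemr tu Vz,
  eI _ Wyz, eI _ Wzx, eI _ Wxy, Ie _ Wyz, Ie _ Wzx, Ie _ Wxy).
have mulV := (peirce_sqr tu Vx, peirce_sqr tu Vy, peirce_sqr tu Vz,
  E, E2, E3, frame_idem_opp fr, frame_idem_opp fr2, frame_idem_opp fr3).
have mulW := (x2, x3, x2', x3', y2, y3, y2', y3', z2, z3, z2', z3',
  w12, w21, w23, w32, w31, w13,
  peirce_sqr tNu Wyz, peirce_sqr tNu Wzx, peirce_sqr tNu Wxy).
move=> [|[|[|[|[|[|[|[|]]]]]]]] // [|[|[|[|[|[|[|[|]]]]]]]] // _ _;
  rewrite /frame_basis /split_mul /= ?big_cons big_nil /= ?addr0
    ?expr0 ?expr1 ?scale1r ?scaleN1r;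
  by rewrite ?omul1 ?omulr1 ?mulI ?mulV ?mulW ?yx ?zy ?xz ?opprK.
Qed.
End SplitFrames.

(** * Automorphisms *)

Section Automorphisms.
Variable F : numFieldType.
Local Notation oct := 'cV[F]_(cd_dim 3).
Local Notation "1o" := (oone F).
Implicit Types (g : 'M[F]_(cd_dim 3)) (x y : oct).

Section Automorphism.
Variable g : 'M[F]_(cd_dim 3).
Hypothesis gG : G2 F g.

Lemma G2_unit : g \in unitmx. Proof. by case: gG. Qed.

Lemma G2_mul x y : g *m (x ** y) = (g *m x) ** (g *m y).
Proof. by case: gG => _ gM; rewrite !omulE gM. Qed.

Lemma G2_one : g *m 1o = 1o.
Proof.
have := G2_mul 1o (invmx g *m 1o).
by rewrite omul1 mulKVmx ?G2_unit // omulr1 => <-.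
Qed.

(** Trace and norm are the coefficients of the quadratic equation of [x], which is
    unique unless [x] is a multiple of 1, and automorphisms fix these multiples. *)
Lemma G2_trace_norm x :
  otrace (g *m x) = otrace x /\ oct_norm (g *m x) = oct_norm x.
Proof.
have E : otrace (g *m x) *: (g *m x) - oct_norm (g *m x) *: 1o =
         otrace x *: (g *m x) - oct_norm x *: 1o.
  by rewrite -oct_sqr -G2_mul oct_sqr mulmxBr -!scalemxAr G2_one.
have {}E : (otrace (g *m x) - otrace x) *: (g *m x) =
           (oct_norm (g *m x) - oct_norm x) *: 1o.
  apply/eqP; rewrite -subr_eq0 !scalerBl; apply/eqP.
  move: E; generalize (g *m x) => y E.
  transitivity (otrace y *: y - oct_norm y *: 1o -
                (otrace x *: y - oct_norm x *: 1o)); first by vec_ring.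
  by rewrite E subrr.
have Et : otrace (g *m x) = otrace x.
  apply/eqP; rewrite -subr_eq0; apply/negPn/negP => d0.
  set d := _ - _ in E d0.
  have : g *m x = (d^-1 * (oct_norm (g *m x) - oct_norm x)) *: 1o.
    by rewrite -scalerA -E scalerA mulVf // scale1r.
  set k := _ * _ => Egx.
  have Ex : x = k *: 1o.
    apply: (can_inj (mulKmx G2_unit)).
    by rewrite -scalemxAr G2_one.
  by move: d0; rewrite /d Egx Ex subrr eqxx.
split=> //; apply/eqP; rewrite -subr_eq0; move: E; rewrite Et subrr scale0r.
move/(congr1 (@otrace F)); rewrite otraceZ otrace1 [LHS]opolar0r => /esym/eqP.
by rewrite mulf_eq0 (negPf (two_neq0 F)) orbF.
Qed.

Lemma G2_trace x : otrace (g *m x) = otrace x.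
Proof. by case: (G2_trace_norm x). Qed.

Lemma G2_polar x y : opolar (g *m x) (g *m y) = opolar x y.
Proof.
have n z : oct_norm (g *m z) = oct_norm z by case: (G2_trace_norm z).
by rewrite !opolarE /oct_polar -mulmxDr !n.
Qed.

Lemma G2_peirce_proj u x : g *m u = u ->
  g *m peirce_proj u x = peirce_proj u (g *m x).
Proof.
move=> gu; have E : opolar u (g *m x) = opolar u x by rewrite -[in LHS]gu G2_polar.
by rewrite /peirce_proj mulmxBr -!scalemxAr !mulmxDr G2_mul G2_one gu G2_trace E.
Qed.
End Automorphism.
End Automorphisms.

(** * Coordinates in a split basis *)

(** A stable subspace contains the eigencomponents of its vectors when the eigenvalues
    are distinct: subtracting l k times the sum from its image kills the component of
    index k. *)
Lemma eigen_components (F : fieldType) (V : vectType F) (A : {vspace V})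
    (f : {linear V -> V}) (I : seq nat) (x : nat -> V) (l : nat -> F) :
    (forall v, v \in A -> f v \in A) -> uniq I -> {in I &, injective l} ->
    (forall i, i \in I -> f (x i) = l i *: x i) ->
  \sum_(i <- I) x i \in A -> forall i, i \in I -> x i \in A.
Proof.
move=> fA; elim: I x => [//|k I IHI] x /= /andP[kI uI] linj fx sA.
have IA i : i \in I -> x i \in A.
  move=> iI; have d0 : l i - l k != 0.
    rewrite subr_eq0; apply: contraNneq kI => /linj <- //; rewrite !inE ?eqxx //.
    by rewrite iI orbT.
  rewrite -[x i]scale1r -(mulVf d0) -scalerA memvZ //.
  move: i iI {d0}; apply: (IHI (fun i => (l i - l k) *: x i)) => //.
  - by move=> i j iI jI; apply: linj; rewrite inE ?iI ?jI orbT.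
  - by move=> i iI; rewrite linearZ /= fx ?inE ?iI ?orbT // !scalerA mulrC.
  have -> : \sum_(i <- I) (l i - l k) *: x i =
      f (\sum_(i <- k :: I) x i) - l k *: \sum_(i <- k :: I) x i.
    rewrite big_cons linearD /= linear_sum /= fx ?mem_head // scalerDr.
    rewrite [_ + \sum_(i <- I) f _]addrC addrKA.
    rewrite scaler_sumr -sumrB big_seq [RHS]big_seq; apply: eq_bigr => i iI.
    by rewrite fx ?inE ?iI ?orbT // scalerBl.
  by rewrite memvB ?fA ?memvZ.
move=> i; rewrite inE => /predU1P[->|/IA //].
have -> : x k = \sum_(i <- k :: I) x i - \sum_(i <- I) x i by rewrite big_cons addrK.
by rewrite memvB // big_seq memv_suml.
Qed.

Section SplitBasis.
Variable F : numFieldType.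
Local Notation oct := 'cV[F]_(cd_dim 3).
Local Notation "1o" := (oone F).
Variable b : nat -> oct.
Hypothesis bP : split_basis b.

Local Notation comb c := (\sum_(k < 8) c (nat_of_ord k) *: b k).

(** The trace form (x, y) |-> t(x y) is nondegenerate on the basis: pairing a relation
    with each vector of the basis isolates one coefficient, up to the block formed by
    the unit and the idempotent. *)
Lemma split_basis_free (c : nat -> F) :
  comb c = 0 -> forall k, (k < 8)%N -> c k = 0.
Proof.
move=> c0; have [b0 t1 t0 bM] := bP.
have T j : (j < 8)%N ->
    \sum_(k < 8) c k * \sum_(p <- split_mul k j) (-1) ^+ p.1 * otrace (b p.2) = 0.
  move=> j8; transitivity (otrace (comb c ** b j)).
    rewrite /otrace omul_suml opolar_sumr; apply: eq_bigr => k _.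
    rewrite omulZl opolarZr bM // opolar_sumr; congr (_ * _).
    by apply: eq_bigr => p _; rewrite opolarZr.
  by rewrite c0 omul0l [LHS]opolar0r.
have tb0 : otrace (b 0%N) = 2 by rewrite b0 otrace1.
have tE := (tb0, t1, t0 2%N isT, t0 3%N isT, t0 4%N isT, t0 5%N isT, t0 6%N isT,
  t0 7%N isT).
have {}T := (T 0%N isT, T 1%N isT, T 2%N isT, T 3%N isT,
  T 4%N isT, T 5%N isT, T 6%N isT, T 7%N isT).
move: T; rewrite !big_ord_recl !big_ord0 /split_mul /= /bump /=.
rewrite !big_cons !big_nil /= !tE.
have two1 : (-1) ^+ 0 * 2 + ((-1) ^+ 1 * 1 + 0) = 1 :> F by ring.
rewrite !two1 !(mulr0, mulr1, addr0, add0r, expr0, mul1r, addn0, add1n).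
move=> [[[[[[[E0 E1] c5] c6] c7] c2] c3] c4] k.
have c0' : c 0%N = 0.
  transitivity (c 0%N * 2 + c 1%N - (c 0%N + c 1%N)); first by ring.
  by rewrite E0 E1 subrr.
have c1 : c 1%N = 0 by move: E1; rewrite c0' add0r.
by move: k => [|[|[|[|[|[|[|[|]]]]]]]].
Qed.

Definition basis_mx : 'M[F]_(cd_dim 3) := \matrix_(i, j) b j i 0.

Lemma basis_mx_mul (c : 'cV_(cd_dim 3)) :
  basis_mx *m c = \sum_(k < 8) c k 0 *: b k.
Proof.
apply/matrixP => i j; rewrite !ord1 mxE summxE; apply: eq_bigr => k _.
by rewrite !mxE mulrC.
Qed.

Lemma basis_mx_unit : basis_mx \in unitmx.
Proof.
rewrite -unitmx_tr -row_free_unit; apply: inj_row_free => v.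
move/(congr1 trmx); rewrite trmx_mul trmxK trmx0 basis_mx_mul => v0.
apply/matrixP => i j; rewrite (ord1 i) [RHS]mxE.
have := @split_basis_free (fun k => v 0 (inord k)) _ j (ltn_ord j).
rewrite inord_val; apply; rewrite -[RHS]v0; apply: eq_bigr => k _.
by rewrite inord_val mxE.
Qed.

Lemma split_basis_span x : exists c : nat -> F, x = comb c.
Proof.
exists (fun k => (invmx basis_mx *m x) (inord k) 0).
rewrite -{1}[x](mulKVmx basis_mx_unit) basis_mx_mul.
by apply: eq_bigr => k _; rewrite inord_val.
Qed.

Lemma split_basis_inj (c d : nat -> F) :
  comb c = comb d -> forall k, (k < 8)%N -> c k = d k.
Proof.
move=> E k k8; apply/eqP; rewrite -subr_eq0; apply/eqP.
apply: (@split_basis_free (fun k => c k - d k)) => //.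
by under eq_bigr do rewrite scalerBl; rewrite sumrB E subrr.
Qed.

Lemma comb_delta k : (k < 8)%N -> comb (fun i => (i == k)%:R) = b k.
Proof.
move=> k8; rewrite (bigD1 (Ordinal k8)) //= eqxx scale1r big1 ?addr0 // => i ik.
by rewrite -val_eqE /= in ik; rewrite (negPf ik) scale0r.
Qed.

Lemma split_span_comb (l : seq nat) x : {in l, forall k, (k < 8)%N} ->
  x \in <<map b l>>%VS ->
  exists2 c : nat -> F, x = comb c & forall k, k \notin l -> c k = 0.
Proof.
elim: l x => [|k l IHl] x l8 /=.
  rewrite span_nil memv0 => /eqP->; exists (fun=> 0) => //.
  by rewrite big1 // => k _; rewrite scale0r.
rewrite span_cons => /memv_addP[y /vlineP[a ->] [z zl ->]].
have [|c -> c0] := IHl z _ zl; first by move=> i il; apply: l8; rewrite inE il orbT.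
exists (fun i => a * (i == k)%:R + c i) => [|i].
  under [RHS]eq_bigr do rewrite scalerDl -scalerA.
  by rewrite big_split /= -scaler_sumr comb_delta // l8 // mem_head.
by rewrite inE negb_or => /andP[/negPf-> /c0->]; rewrite mulr0 addr0.
Qed.

Lemma mem_split_span (l : seq nat) k : {in l, forall k, (k < 8)%N} -> (k < 8)%N ->
  (b k \in <<map b l>>%VS) = (k \in l).
Proof.
move=> l8 k8; apply/idP/idP => [kl|kl]; last by rewrite memv_span // map_f.
have [c E c0] := split_span_comb l8 kl; apply/negPn/negP => /c0.
rewrite -comb_delta // in E; have := @split_basis_inj (fun i => (i == k)%:R) c E k k8.
by rewrite eqxx => <- /eqP; rewrite oner_eq0.
Qed.

Lemma split_span_dim (l : seq nat) : {in l, forall k, (k < 8)%N} -> uniq l ->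
  \dim <<map b l>> = size l.
Proof.
move=> l8 ul; rewrite -(size_map b); apply/eqP; rewrite -/(free _).
elim: l l8 ul => [|k l IHl] l8 /=; first by rewrite nil_free.
move=> /andP[kl ul]; rewrite free_cons mem_split_span ?kl ?IHl //=.
- by move=> i il; apply: l8; rewrite inE il orbT.
- by move=> i il; apply: l8; rewrite inE il orbT.
by rewrite l8 // mem_head.
Qed.
End SplitBasis.

(** * Stable subalgebras *)

Fixpoint sublists (s : seq nat) : seq (seq nat) :=
  if s is x :: s' then map (cons x) (sublists s') ++ sublists s' else [:: [::]].

Lemma filter_sublists p s : filter p s \in sublists s.
Proof.
elim: s => //= x s IHs; rewrite mem_cat; case: (p x).
  by rewrite map_f.
by rewrite IHs orbT.
Qed.

Definition mul_closed (s : seq nat) : bool :=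
  all (fun i => all (fun j => all (fun p => p.2 \in s) (split_mul i j)) s) s.

(** The three-element sets s of indices such that 1 and the b k, for k in s, span a
    subalgebra.  In the notation of the opening comment they are {e, xi, yj}
    for any i and j, and {xi, xj, yk} and {yi, yj, xk} for distinct i, j, k. *)
Definition split_codes : seq (seq nat) :=
  [seq s <- sublists (iota 1 7) | (size s == 3%N) && mul_closed (0%N :: s)].

Lemma size_split_codes : size split_codes = 15%N.
Proof. by vm_compute. Qed.

Lemma uniq_split_codes : uniq split_codes.
Proof. by vm_compute. Qed.

(** The shapes of the entries of the table: b i ** b j lies in a subspace containing 1
    exactly when all the b k occurring in it do. *)
Variant split_mul_spec : seq (bool * nat) -> Prop :=
  | SplitMul0 : split_mul_spec [::]
  | SplitMul1 p : (p.2 < 8)%N -> split_mul_spec [:: p]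
  | SplitMul2 : split_mul_spec [:: (false, 0%N); (true, 1%N)].

Lemma split_mulP i j : (i < 8)%N -> (j < 8)%N -> split_mul_spec (split_mul i j).
Proof.
move: i j => [|[|[|[|[|[|[|[|]]]]]]]] // [|[|[|[|[|[|[|[|]]]]]]]] // _ _;
  rewrite /split_mul /=; by constructor.
Qed.

Lemma split_codesP s : s \in split_codes ->
  [/\ {in 0%N :: s, forall k, (k < 8)%N}, uniq (0%N :: s), size s = 3%N,
      mul_closed (0%N :: s) & filter (mem (0%N :: s)) (iota 1 7) = s].
Proof.
have : all (fun s => [&& all (fun k => k < 8)%N (0%N :: s), uniq (0%N :: s),
   size s == 3%N, mul_closed (0%N :: s) &
   filter (mem (0%N :: s)) (iota 1 7) == s]) split_codes by vm_compute.
move/allP => H /H /and5P[/allP ? ? /eqP ? ? /eqP ?]; by split.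
Qed.

Section FixedPoints.
Variable F : numFieldType.
Local Notation oct := 'cV[F]_(cd_dim 3).
Local Notation "1o" := (oone F).

Lemma mem_oct_im (x : oct) : (x \in oct_im F) = (otrace x == 0).
Proof. by rewrite memv_oct_im /otrace opolarE ooneE. Qed.

Lemma mem_im_part (A : {vspace oct}) x : 1o \in A -> x \in A ->
  im_part x \in (A :&: oct_im F)%VS.
Proof.
by move=> A1 Ax; rewrite memv_cap mem_oct_im otrace_im_part eqxx andbT memvB ?memvZ.
Qed.

Variable b : nat -> oct.
Hypothesis bP : split_basis b.
Local Notation comb c := (\sum_(k < 8) c (nat_of_ord k) *: b k).

Definition code_space (s : seq nat) : {vspace oct} := <<map b (0%N :: s)>>%VS.

Lemma code_space_one s : 1o \in code_space s.
Proof. by have [<- _ _ _] := bP; rewrite memv_span // mem_head. Qed.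

Lemma code_space_subalgebra s : s \in split_codes ->
  oct_subalgebra (code_space s) /\ \dim (code_space s) = 4%N.
Proof.
case/split_codesP => s8 us s3 cl _; split; last first.
  by rewrite (split_span_dim bP) //= s3.
split=> [|x y]; first by rewrite -ooneE code_space_one.
move=> /(split_span_comb s8)[c -> c0] /(split_span_comb s8)[d -> d0].
rewrite -omulE omul_suml memv_suml // => i _; rewrite omul_sumr memv_suml // => j _.
rewrite omulZl omulZr.
have [iS|/c0->] := boolP (nat_of_ord i \in 0%N :: s); last by rewrite scale0r mem0v.
have [jS|/d0->] := boolP (nat_of_ord j \in 0%N :: s);
  last by rewrite scale0r scaler0 mem0v.
have [_ _ _ ->] := bP => //; rewrite !memvZ // big_seq memv_suml // => p pij.
rewrite memvZ // memv_span // map_f //.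
by move/allP: cl => /(_ _ iS)/allP/(_ _ jS)/allP/(_ _ pij).
Qed.

(** A subspace containing 1 is the sum of its imaginary part and the line of 1. *)
Lemma im_subalgebra_inj (A B : {vspace oct}) : 1o \in A -> 1o \in B ->
  (A :&: oct_im F = B :&: oct_im F)%VS -> A = B.
Proof.
have sub (C D : {vspace oct}) : 1o \in C -> 1o \in D ->
    (C :&: oct_im F = D :&: oct_im F)%VS -> (C <= D)%VS.
  move=> C1 D1 E; apply/subvP => x xC.
  rewrite -[x]im_partK memvD ?memvZ //.
  by have := mem_im_part C1 xC; rewrite E memv_cap => /andP[].
by move=> A1 B1 E; apply/eqP; rewrite eqEsubv !sub.
Qed.

Lemma code_space_inv s : s \in split_codes ->
  filter (fun k => b k \in code_space s) (iota 1 7) = s.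
Proof.
case/split_codesP => s8 _ _ _ Es; rewrite -[RHS]Es; apply: eq_in_filter => k.
by rewrite mem_iota => /andP[_ k8]; rewrite /code_space (mem_split_span bP).
Qed.

Section Torus.
Variable T : set 'M[F]_(cd_dim 3).
Hypothesis TG2 : T `<=` G2 F.
Hypothesis T_diag : forall g, T g -> forall k, (k < 8)%N ->
  exists a, g *m b k = a *: b k.
Hypothesis T_regular : exists g (l : nat -> F), [/\ T g,
  {in iota 1 7 &, injective l} & {in iota 1 7, forall k, g *m b k = l k *: b k}].

Lemma code_space_fixed s : s \in split_codes ->
  gl_fixed T (code_space s :&: oct_im F)%VS.
Proof.
case/split_codesP => s8 _ _ _ _ g Tg.
have gG := TG2 Tg; have gU := G2_unit gG.
set W := (_ :&: _)%VS.
have gE x : linfun (mulmx g) x = g *m x :> oct by rewrite lfunE.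
have gW : (linfun (mulmx g) @: W <= W)%VS.
  apply/subvP => _ /memv_imgP[x + ->]; rewrite gE !memv_cap => /andP[xs].
  rewrite !mem_oct_im (G2_trace gG) => ->; rewrite andbT.
  have [c -> c0] := split_span_comb s8 xs.
  rewrite mulmx_sumr memv_suml // => k _; rewrite -scalemxAr.
  have [ks|/c0->] := boolP (nat_of_ord k \in 0%N :: s); last by rewrite scale0r mem0v.
  have [a ->] := T_diag Tg (ltn_ord k).
  by rewrite !memvZ // memv_span // map_f.
have K : (W :&: lker (linfun (mulmx g)) = 0)%VS.
  apply/eqP; rewrite -subv0; apply/subvP => x; rewrite memv_cap memv_ker gE.
  by case/andP=> _ /eqP gx0; rewrite memv0 -(mulKmx gU x) gx0 mulmx0.
by apply/eqP; rewrite eqEdim gW (limg_dim_eq K) leqnn.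
Qed.

(** The vectors b 1, ..., b 7 have distinct eigenvalues for the regular element, so [A],
    which contains b 0 = 1, is spanned by the b k that it contains. *)
Lemma fixed_code_space (A : {vspace oct}) : oct_subalgebra A -> \dim A = 4%N ->
  gl_fixed T (A :&: oct_im F)%VS ->
  exists2 s, s \in split_codes & A = code_space s.
Proof.
move=> [A1 AM] dA Afix.
rewrite -ooneE in A1.
have [b0 _ _ bM] := bP; have [g [l [Tg linj gb]]] := T_regular.
have gA x : x \in A -> g *m x \in A.
  move=> xA; rewrite -[x]im_partK mulmxDr -scalemxAr.
  rewrite (G2_one (TG2 Tg)) memvD ?memvZ //.
  have := memv_img (linfun (mulmx g)) (mem_im_part A1 xA).
  by rewrite (Afix _ Tg) memv_cap lfunE => /andP[].
pose s := filter (fun k => b k \in A) (iota 1 7).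
have s8 : {in 0%N :: s, forall k, (k < 8)%N}.
  move=> k; rewrite inE mem_filter mem_iota => /predU1P[-> //|].
  by case/and3P.
have us : uniq (0%N :: s).
  by rewrite cons_uniq filter_uniq ?iota_uniq // mem_filter mem_iota andbF.
have sA k : k \in 0%N :: s -> b k \in A.
  by rewrite inE mem_filter => /predU1P[->|/andP[]//]; rewrite b0.
(* b 0 and b 1 share the eigenvalue 1, so the component along b 0, which belongs to
   [A] anyway, is removed before splitting into eigencomponents. *)
have EA : A = code_space s.
  apply/eqP; rewrite eqEsubv; apply/andP; split; last first.
    by apply/span_subvP => _ /mapP[k ks ->]; exact: sA.
  apply/subvP => x xA; have [c Ex] := split_basis_span bP x.
  have cA : forall k, k \in iota 1 7 -> c k *: b k \in A.
    apply: (@eigen_components F oct A (mulmx g) (iota 1 7)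
      (fun k => c k *: b k) l) => //.
    - by move=> k k7; rewrite /= -scalemxAr gb // !scalerA mulrC.
    have -> : \sum_(i <- iota 1 7) c i *: b i = x - c 0%N *: 1o.
      rewrite Ex -(big_mkord xpredT (fun k => c k *: b k)) big_ltn // b0.
      by rewrite addrC addKr.
    by rewrite memvB ?memvZ.
  rewrite Ex memv_suml // => k _.
  have [->|k0] := eqVneq (nat_of_ord k) 0%N.
    by rewrite memvZ // memv_span // mem_head.
  have kI : nat_of_ord k \in iota 1 7 by rewrite mem_iota lt0n k0 /=.
  have [->|ck] := eqVneq (c k) 0; first by rewrite scale0r mem0v.
  rewrite memvZ // memv_span // map_f // inE mem_filter kI andbT; apply/orP; right.
  by have := memvZ (c k)^-1 (cA _ kI); rewrite scalerA mulVf // scale1r.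
exists s => //; rewrite mem_filter filter_sublists andbT; apply/andP; split.
  by move: dA; rewrite EA (split_span_dim bP) //= => -[->].
apply/allP => i iS; apply/allP => j jS; apply/allP => p pij.
have i8 := s8 _ iS; have j8 := s8 _ jS.
have bij : b i ** b j \in A by rewrite omulE AM ?sA.
have memA k : (k < 8)%N -> (k \in 0%N :: s) = (b k \in A).
  by move=> k8; rewrite EA /code_space (mem_split_span bP).
move: bij pij; rewrite bM //; case: (split_mulP i8 j8) => [|q q8|].
- by [].
- rewrite big_seq1 inE => bq /eqP->; rewrite memA //.
  by rewrite -[b _]scale1r -(signrMK q.1 1) mulr1 -scalerA memvZ.
rewrite !inE => b1A /orP[]/eqP->; first by [].
rewrite -[_ || _]/(1%N \in 0%N :: s) memA //.
have -> : b 1%N = b 0%N -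
    \sum_(p <- [:: (false, 0%N); (true, 1%N)]) (-1) ^+ p.1 *: b p.2.
  by rewrite !big_cons big_nil addr0 /= expr0 expr1 scale1r scaleN1r subKr.
by rewrite memvB // b0.
Qed.

Lemma card_fixed : (CG F `&` gl_fixed T) #= `I_15.
Proof.
pose f k := (code_space (nth [::] split_codes k) :&: oct_im F)%VS.
have -> : CG F `&` gl_fixed T = f @` `I_15.
  apply/seteqP; split=> [W [[A [Aalg dA] <-] Afix]|W [k k15 <-]].
    have [s sC ->] := fixed_code_space Aalg dA Afix.
    exists (index s split_codes); last by rewrite /f nth_index.
    by have := sC; rewrite -index_mem size_split_codes.
  have sC : nth [::] split_codes k \in split_codes.
    by rewrite mem_nth // size_split_codes.
  split; last exact: code_space_fixed.
  by exists (code_space (nth [::] split_codes k)) => //; exact: code_space_subalgebra.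
apply: inj_card_eq => i j; rewrite !in_setE => i15 j15 Eij.
have iC : nth [::] split_codes i \in split_codes.
  by rewrite mem_nth // size_split_codes.
have jC : nth [::] split_codes j \in split_codes.
  by rewrite mem_nth // size_split_codes.
have E := im_subalgebra_inj (code_space_one _) (code_space_one _) Eij.
apply/eqP; rewrite -(nth_uniq [::] _ _ uniq_split_codes) ?size_split_codes //.
apply/eqP; rewrite -(code_space_inv iC) E code_space_inv //.
Qed.
End Torus.
End FixedPoints.

(** * Tori are diagonalizable *)

Section Codiagonalization.

Lemma finite_spanning (F : fieldType) (V : vectType F) (X : set V) :
  exists2 s : seq V, forall v, v \in s -> X v & forall v, X v -> v \in <<s>>%VS.
Proof.
suff H n (s : seq V) : (forall v, v \in s -> X v) ->
    (\dim {:V} - \dim <<s>> <= n)%N ->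
    exists2 s : seq V, forall v, v \in s -> X v & forall v, X v -> v \in <<s>>%VS.
  exact: (H _ [::]).
elim: n s => [|n IHn] s sX sn.
  exists s => // v _; suff -> : <<s>>%VS = fullv by rewrite memvf.
  by apply/eqP; rewrite eqEdim subvf; rewrite leqn0 subn_eq0 in sn.
case: (pselect (forall v, X v -> v \in <<s>>%VS)) => [|]; first by exists s.
move/existsNP => [v] /not_implyP[Xv /negP vs]; apply: (IHn (v :: s)) => [w|].
  by rewrite inE => /predU1P[->|/sX].
have lt : (\dim <<s>> < \dim <<v :: s>>)%N.
  rewrite span_cons ltnNge; apply: contra vs => le.
  have := eqEdim <<s>> (<[v]> + <<s>>)%VS; rewrite addvSr le => /eqP ->.
  exact: (subvP (addvSl _ _) _ (memv_line v)).
rewrite -ltnS (leq_trans _ sn) // ltn_sub2l //.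
exact: leq_trans lt (dimvS (subvf _)).
Qed.

(** A family of matrices is diagonal in a basis as soon as a finite spanning part of it
    is, which reduces the claim to finite families. *)
Lemma codiagonalizable_set (F : fieldType) n (X : set 'M[F]_n) :
    (forall A B, X A -> X B -> comm_mx A B) ->
    (forall A, X A -> diagonalizable A) ->
  exists2 P, P \in unitmx & forall A, X A -> is_diag_mx (P *m A *m invmx P).
Proof.
move=> Xcomm Xdiag; have [s sX Xs] := finite_spanning X.
have [P Pu /allP Ps] : codiagonalizable s.
  apply/codiagonalizableP; split=> [A B As Bs|A As].
    by apply: Xcomm; exact: sX.
  by apply: Xdiag; exact: sX.
exists P => // A /Xs /(coord_span (X := in_tuple s)) ->.
apply/is_diag_mxP => i j ij; rewrite mulmx_sumr mulmx_suml summxE big1 // => k _.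
rewrite -scalemxAr -scalemxAl mxE.
have := Ps _ (mem_nth 0 (ltn_ord k)); rewrite /= /similar_to conjumx //.
by move/is_diag_mxP => ->; rewrite ?mulr0.
Qed.

Lemma roots_of_unity (F : numClosedFieldType) n : (0 < n)%N ->
  exists rs : seq F, [/\ uniq rs, size rs = n &
    'X^n - 1 = \prod_(z <- rs) ('X - z%:P)].
Proof.
move=> n0; have [rs E] := closed_field_poly_normal ('X^n - 1 : {poly F}).
have E' : 'X^n - 1 = \prod_(z <- rs) ('X - z%:P) :> {poly F}.
  by rewrite {1}E (monicP _) ?scale1r //; apply: monicXnsubC.
exists rs; split=> //; last first.
  have := congr1 (size \o @polyseq F) E'.
  by rewrite /= size_prod_XsubC size_XnsubC // => -[].
by rewrite -separable_prod_XsubC -E' separable_Xn_sub_1 // pnatr_eq0 -lt0n.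
Qed.

Lemma diagonalizable_finite_order (F : numClosedFieldType) m n (A : 'M[F]_m.+1) :
  (0 < n)%N -> A ^+ n = 1 -> diagonalizable A.
Proof.
move=> n0 An; have [rs [urs _ E]] := roots_of_unity F n0.
apply/diagonalizableP; exists rs => //; rewrite -E mxminpoly_min //.
by rewrite rmorphB rmorphXn /= rmorph1 horner_mx_X An subrr.
Qed.
End Codiagonalization.

Section Laurent.
Variable F : numClosedFieldType.
Implicit Types h k : F -> F.

(** Agrees off 0 with a Laurent polynomial, written with its denominator cleared. *)
Definition laurent h := exists N (q : {poly F}),
  forall a : F, a != 0 -> a ^+ N * h a = q.[a].

Lemma laurent_cst c : laurent (fun=> c).
Proof. by exists 0%N, c%:P => a _; rewrite mul1r hornerC. Qed.

Lemma laurent_id : laurent id.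
Proof. by exists 0%N, 'X => a _; rewrite mul1r hornerX. Qed.

Lemma laurentV : laurent (fun a => a^-1).
Proof. by exists 1%N, 1 => a a0; rewrite mulfV // hornerC. Qed.

Lemma laurentD h k : laurent h -> laurent k -> laurent (fun a => h a + k a).
Proof.
move=> [M [p hp]] [N [q kq]]; exists (M + N)%N, ('X^N * p + 'X^M * q) => a a0.
by rewrite hornerD !hornerM !hornerXn -hp // -kq // exprD; ring.
Qed.

Lemma laurentM h k : laurent h -> laurent k -> laurent (fun a => h a * k a).
Proof.
move=> [M [p hp]] [N [q kq]]; exists (M + N)%N, (p * q) => a a0.
by rewrite hornerM -hp // -kq // exprD mulrACA.
Qed.

Lemma laurent_sum (I : Type) (r : seq I) (h : I -> F -> F) :
  (forall i, laurent (h i)) -> laurent (fun a => \sum_(i <- r) h i a).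
Proof.
move=> lh; elim: r => [|i r IHr].
  by have [N [q E]] := laurent_cst 0; exists N, q => a a0; rewrite big_nil E.
have [N [q E]] := laurentD (lh i) IHr; exists N, q => a a0.
by rewrite big_cons E.
Qed.

Lemma laurent_prod (I : Type) (r : seq I) (h : I -> F -> F) :
  (forall i, laurent (h i)) -> laurent (fun a => \prod_(i <- r) h i a).
Proof.
move=> lh; elim: r => [|i r IHr].
  by have [N [q E]] := laurent_cst 1; exists N, q => a a0; rewrite big_nil E.
have [N [q E]] := laurentM (lh i) IHr; exists N, q => a a0.
by rewrite big_cons E.
Qed.

Lemma laurentX h n : laurent h -> laurent (fun a => h a ^+ n).
Proof.
move=> lh; have [N [q E]] := laurent_prod (index_enum 'I_n) (fun=> lh).
by exists N, q => a a0; rewrite -E // prodr_const card_ord.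
Qed.

Lemma laurent_eval n (p : mpoly.mpoly (n * n + 1) F) (c : F -> 'M[F]_n) :
  (forall i, laurent (fun a => gl_coord (c a) 0 i)) ->
  laurent (fun a => gl_eval p (c a)).
Proof.
move=> lc; rewrite /gl_eval.
have [N [q E]] := laurent_sum (msupp p) (fun m =>
  laurentM (laurent_cst p@_m) (laurent_prod (index_enum 'I_(n * n + 1))
     (fun i => laurentX (m i) (lc i)))).
by exists N, q => a a0; rewrite -E.
Qed.

(** The n-th roots of unity outnumber the zeros of a nonzero polynomial of degree less
    than n. *)
Lemma laurent_eq0 h : laurent h ->
  (forall n z, (0 < n)%N -> z ^+ n = 1 -> h z = 0) -> forall a, a != 0 -> h a = 0.
Proof.
move=> [N [q hq]] h0 a a0; have [rs [urs srs E]] := roots_of_unity F (ltn0Sn (size q)).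
suff q0 : q = 0.
  have /eqP := hq a a0; rewrite q0 horner0 mulf_eq0 expf_eq0 (negPf a0) andbF.
  by move/eqP.
apply/eqP/negPn/negP => /max_poly_roots/(_ _ urs); rewrite srs ltnNge leqnSn.
move=> H; suff: false by []; apply: H; apply/allP => z zrs.
have z1 : z ^+ (size q).+1 = 1.
  have : root ('X^((size q).+1) - 1) z by rewrite E root_prod_XsubC.
  by rewrite rootE !hornerE subr_eq0 => /eqP.
have z0 : z != 0.
  by apply: contra_eq_neq z1 => ->; rewrite exprS mul0r eq_sym oner_eq0.
by rewrite rootE -hq // (h0 _ _ _ z1) ?mulr0.
Qed.
End Laurent.

Section Tori.
Variable F : numClosedFieldType.

Definition tdiag r (t : 'I_r -> F) : 'M[F]_r := diag_mx (\row_i t i).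

Lemma tdiagM r (s t : 'I_r -> F) :
  tdiag s *m tdiag t = tdiag (fun i => s i * t i).
Proof.
rewrite /tdiag mulmx_diag; congr diag_mx.
by apply/matrixP => i j; rewrite !mxE.
Qed.

Lemma det_tdiag r (t : 'I_r -> F) : \det (tdiag t) = \prod_i t i.
Proof. by rewrite /tdiag det_diag; apply: eq_bigr => i _; rewrite mxE. Qed.

Lemma diag_torus_tdiag r (t : 'I_r -> F) :
  (forall i, t i != 0) -> diag_torus (tdiag t).
Proof.
move=> t0; split; last exact: diag_mx_is_diag.
by rewrite unitmxE det_tdiag unitfE; apply/prodf_neq0 => i _.
Qed.

Lemma diag_torusP r (g : 'M[F]_r) : diag_torus g ->
  exists2 t : 'I_r -> F, forall i, t i != 0 & g = tdiag t.
Proof.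
move=> [gU /diag_mxP[d gE]]; exists (fun i => d 0 i); last first.
  by rewrite gE /tdiag; congr diag_mx; apply/rowP => i; rewrite mxE.
move=> i; move: gU; rewrite gE unitmxE det_diag unitfE => /prodf_neq0; exact.
Qed.

(** The k-th coordinate one-parameter subgroup of the diagonal torus. *)
Definition cochar r (k : 'I_r) (a : F) : 'I_r -> F :=
  fun i => if i == k then a else 1.

Lemma cochar_neq0 r (k : 'I_r) a : a != 0 -> forall i, cochar k a i != 0.
Proof.
by move=> a0 i; rewrite /cochar; case: (i =P k) => // _; exact: oner_neq0.
Qed.

Lemma laurent_cochar r (k : 'I_r) i :
  laurent (fun a => gl_coord (tdiag (cochar k a)) 0 i).
Proof.
have [->|[j ->]] : i = rshift _ 0 \/ exists j, i = lshift 1 j.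
  by case: (splitP i) => [j Ej|j Ej]; [right; exists j | left];
     apply: val_inj; rewrite //= Ej (ord1 j).
- have [N [q E]] := laurentV F; exists N, q => a a0.
  rewrite -E // /gl_coord row_mxEr mxE mulr1n det_tdiag.
  rewrite (bigD1 k) //= big1 => [|l lk]; last by rewrite /cochar (negPf lk).
  by rewrite /cochar eqxx mulr1.
case/mxvec_indexP: j => x y.
have E a : gl_coord (tdiag (cochar k a)) 0 (lshift 1 (mxvec_index x y)) =
    cochar k a x *+ (x == y).
  by rewrite /gl_coord row_mxEl mxvecE !mxE; case: eqP => // ->.
have [xy|xy] := eqVneq x y; last first.
  have [N [q Eq]] := laurent_cst (0 : F); exists N, q => a a0.
  by rewrite E (negPf xy) -Eq.
have [xk|xk] := eqVneq x k.
  have [N [q Eq]] := laurent_id F; exists N, q => a a0.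
  by rewrite E xy eqxx mulr1n -xy /cochar xk eqxx -Eq.
have [N [q Eq]] := laurent_cst (1 : F); exists N, q => a a0.
by rewrite E xy eqxx mulr1n -xy /cochar (negPf xk) -Eq.
Qed.

Section Torus.
Variables (n : nat) (T : set 'M[F]_n.+1).
Hypothesis TT : is_torus T.

Lemma torus_comm g h : T g -> T h -> comm_mx g h.
Proof.
have [_ [r [f [f' [[_ fM _] [f'T _ _] _ f'K]]]]] := TT.
move=> Tg Th; rewrite /comm_mx -(f'K _ Tg) -(f'K _ Th).
have Dg := f'T _ Tg; have Dh := f'T _ Th.
rewrite -!fM //; congr f; move: Dg Dh => [_ /diag_mxP[d ->]] [_ /diag_mxP[e ->]].
by rewrite diag_mxC.
Qed.

(** Over an algebraically closed field tori are divisible.  This replaces connectedness: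
    it excludes nontrivial characters of order two ([weight_sqr_eq1]). *)
Lemma torus_sqrt g : T g -> exists2 h, T h & g = h *m h.
Proof.
have [_ [r [f [f' [[fT fM _] [f'T _ _] _ f'K]]]]] := TT.
move=> Tg; have [t t0 Et] := diag_torusP (f'T _ Tg).
have st0 i : sqrtC (t i) != 0 by rewrite sqrtC_eq0.
exists (f (tdiag (fun i => sqrtC (t i)))); first exact/fT/diag_torus_tdiag.
rewrite -fM; [|exact: diag_torus_tdiag|exact: diag_torus_tdiag].
rewrite -[LHS]f'K // Et tdiagM; congr (f (diag_mx _)).
by apply/rowP => i; rewrite !mxE -expr2 sqrtCK.
Qed.

(** The images of roots of unity under the coordinate one-parameter subgroups have
    finite order and commute, so one basis diagonalizes them all.  In this basis the
    off-diagonal entries of a one-parameter subgroup are Laurent polynomials vanishing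
    at all roots of unity, hence zero, and the torus is generated by these subgroups. *)
Lemma torus_diagonalizable :
  exists2 P, P \in unitmx & forall g, T g -> is_diag_mx (P *m g *m invmx P).
Proof.
have [[_ [TU _ _ _]] [r [f [f' [[fT fM freg] [f'T _ _] _ f'K]]]]] := TT.
have tT t : (forall i, t i != 0) -> diag_torus (@tdiag r t).
  exact: diag_torus_tdiag.
have one0 (i : 'I_r) : (1 : F) != 0 by exact: oner_neq0.
have f1 : f (tdiag (fun=> 1)) = 1%:M.
  have /(_ _ (fT _ (tT _ one0))) U := TU.
  apply: (can_inj (mulKmx U)); rewrite mulmx1 -fM; [|exact: tT|exact: tT].
  by rewrite tdiagM; congr (f (diag_mx _)); apply/rowP => i; rewrite !mxE mulr1.
have fX k a m : a != 0 ->
    f (tdiag (cochar k a)) ^+ m = f (tdiag (cochar k (a ^+ m))).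
  move=> a0; elim: m => [|m IHm].
    rewrite !expr0 -[LHS]f1; congr (f (diag_mx _)); apply/rowP => i.
    by rewrite !mxE /cochar if_same.
  rewrite exprS IHm -[LHS]/(_ *m _) -fM.
  - rewrite tdiagM; congr (f (diag_mx _)); apply/rowP => i.
    by rewrite !mxE /cochar exprS; case: eqP; rewrite // mulr1.
  - exact/tT/cochar_neq0.
  - exact/tT/cochar_neq0/expf_neq0.
pose X : set 'M[F]_n.+1 := [set A | exists k z m, [/\ (0 < m)%N, z ^+ m = 1 &
  A = f (tdiag (cochar k z))]].
have z0 (z : F) m : (0 < m)%N -> z ^+ m = 1 -> z != 0.
  case: m => // m _ z1; apply: contra_eq_neq z1 => ->.
  by rewrite exprS mul0r eq_sym oner_eq0.
have [|A|P Pu PX] := @codiagonalizable_set F n.+1 X.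
- move=> A B [k [z [m [m0 z1 ->]]]] [l [y [p [p0 y1 ->]]]].
  by apply: torus_comm; apply/fT/tT/cochar_neq0; [apply: z0 z1|apply: z0 y1].
- move=> [k [z [m [m0 z1 ->]]]]; apply: (diagonalizable_finite_order m0).
  rewrite fX ?(z0 _ _ m0 z1) // z1 -[RHS]f1; congr (f (diag_mx _)).
  by apply/rowP => i; rewrite !mxE /cochar if_same.
exists P => //.
have Pcochar k a : a != 0 -> is_diag_mx (P *m f (tdiag (cochar k a)) *m invmx P).
  move=> a0; apply/is_diag_mxP => i j ij.
  pose h a := (P *m f (tdiag (cochar k a)) *m invmx P) i j.
  apply: (@laurent_eq0 F h) => // [|m z m0 z1]; last first.
    have Xz : X (f (tdiag (cochar k z))) by exists k, z, m.
    by have /is_diag_mxP := PX _ Xz; apply.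
  have [p pE] : exists p : 'I_n.+1 -> 'I_n.+1 -> mpoly.mpoly (r * r + 1) F,
      forall x y g, diag_torus g -> f g x y = gl_eval (p x y) g.
    have /fin_all_exists[p pE] : forall xy : 'I_n.+1 * 'I_n.+1,
        exists p, forall g, diag_torus g -> f g xy.1 xy.2 = gl_eval p g.
      by move=> xy; apply: freg.
    by exists (fun x y => p (x, y)) => x y g; apply: (pE (x, y)).
  have lp x y : laurent (fun a => gl_eval (p x y) (tdiag (cochar k a))).
    by apply: laurent_eval => l; apply: laurent_cochar.
  have [N [q qE]] := laurent_sum (index_enum 'I_n.+1) (fun y => laurentM
    (laurent_sum (index_enum 'I_n.+1) (fun x =>
       laurentM (laurent_cst (P i x)) (lp x y)))
    (laurent_cst (invmx P y j))).
  exists N, q => b b0; rewrite -qE // /h mxE; congr (_ * _).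
  apply: eq_bigr => y _; rewrite mxE; congr (_ * _).
  by apply: eq_bigr => x _; rewrite pE //; exact/tT/cochar_neq0.
suff Ptdiag (s : seq 'I_r) t : (forall i, t i != 0) ->
    (forall i, i \notin s -> t i = 1) ->
    is_diag_mx (P *m f (tdiag t) *m invmx P).
  move=> g Tg; have [t t0 Et] := diag_torusP (f'T _ Tg).
  rewrite -(f'K _ Tg) Et; apply: (Ptdiag (index_enum 'I_r)) => // i.
  by rewrite mem_index_enum.
elim: s t => [|k s IHs] t t0 t1.
  have -> : tdiag t = tdiag (fun=> 1).
    by congr diag_mx; apply/rowP => i; rewrite !mxE t1.
  by rewrite f1 mulmx1 mulmxV //; exact: scalar_mx_is_diag.
pose t' i := if i == k then 1 else t i.
have t'0 i : t' i != 0 by rewrite /t'; case: (i =P k) => // _; exact: oner_neq0.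
have -> : tdiag t = tdiag (cochar k (t k)) *m tdiag t'.
  rewrite tdiagM; congr diag_mx; apply/rowP => i; rewrite !mxE /cochar /t'.
  by case: eqP => [->|]; rewrite ?mulr1 ?mul1r.
rewrite fM; [|exact/tT/cochar_neq0|exact: tT].
have /diag_mxP[d Ed] := Pcochar k _ (t0 k).
have /diag_mxP[e Ee] : is_diag_mx (P *m f (tdiag t') *m invmx P).
  apply: IHs => // i iS; rewrite /t'; case: eqP => // /eqP ik; apply: t1.
  by rewrite inE negb_or ik.
have -> : P *m (f (tdiag (cochar k (t k))) *m f (tdiag t')) *m invmx P =
    (P *m f (tdiag (cochar k (t k))) *m invmx P) *m
    (P *m f (tdiag t') *m invmx P).
  by rewrite !mulmxA mulmxKV.
by rewrite Ed Ee mulmx_diag diag_mx_is_diag.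
Qed.
End Torus.
End Tori.

(** * The torus of a split basis *)

Section Regular.
Variables (F : fieldType) (n : nat) (X : set 'M[F]_n).
Implicit Types h k : 'M[F]_n -> F.

Definition regular_on h := exists p, forall g, X g -> h g = gl_eval p g.

Lemma regular_cst c : regular_on (fun=> c).
Proof. by exists (mpolyC _ c) => g _; rewrite /gl_eval mevalC. Qed.

Lemma regularD h k : regular_on h -> regular_on k -> regular_on (fun g => h g + k g).
Proof.
by move=> [p hp] [q kq]; exists (p + q) => g Xg; rewrite hp // kq // /gl_eval mevalD.
Qed.

Lemma regularM h k : regular_on h -> regular_on k -> regular_on (fun g => h g * k g).
Proof.
by move=> [p hp] [q kq]; exists (p * q) => g Xg; rewrite hp // kq // /gl_eval mevalM.
Qed.

Lemma regular_sum (I : Type) (r : seq I) (h : I -> 'M[F]_n -> F) :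
  (forall i, regular_on (h i)) -> regular_on (fun g => \sum_(i <- r) h i g).
Proof.
move=> rh; elim: r => [|i r IHr].
  by have [p E] := regular_cst 0; exists p => g Xg; rewrite big_nil -E.
have [p E] := regularD (rh i) IHr; exists p => g Xg.
by rewrite big_cons -E.
Qed.

Lemma regular_coord i : regular_on (fun g => gl_coord g 0 i).
Proof. by exists ('X_i)%MP => g _; rewrite /gl_eval mevalXU. Qed.

Lemma regular_entry i j : regular_on (fun g => g i j).
Proof.
have [p E] := regular_coord (lshift 1 (mxvec_index i j)); exists p => g Xg.
by rewrite -E // /gl_coord row_mxEl mxvecE.
Qed.

Lemma regular_invdet : regular_on (fun g => (\det g)^-1).
Proof.
have [p E] := regular_coord (rshift (n * n) 0); exists p => g Xg.
by rewrite -E // /gl_coord row_mxEr mxE mulr1n.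
Qed.

Lemma regular_conj (A B : 'M[F]_n) i j : regular_on (fun g => (A *m g *m B) i j).
Proof.
have [p E] := regular_sum (index_enum 'I_n) (fun y => regularM
  (regular_sum (index_enum 'I_n) (fun x =>
     regularM (regular_cst (A i x)) (regular_entry x y)))
  (regular_cst (B y j))).
exists p => g Xg; rewrite -E // mxE; apply: eq_bigr => y _; rewrite mxE.
by [].
Qed.
End Regular.

(** The zero locus of the ideal of [X] is its closure, so [X] is closed if it can be cut
    out by regular functions vanishing on it. *)
Lemma gl_closedP (F : fieldType) n (X : set 'M[F]_n) :
    X `<=` [set g | g \in unitmx] ->
    (forall g, g \in unitmx -> (forall h, regular_on setT h ->
       (forall x, X x -> h x = 0) -> h g = 0) -> X g) ->
  gl_closed X.
Proof.
move=> XU XP; exists [set p | forall x, X x -> gl_eval p x = 0].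
apply/seteqP; split=> [g Xg|g [gU gS]]; first by split; [exact: XU | move=> p; exact].
by apply: XP => // h [p hp] h0; rewrite hp //; apply: gS => x Xx; rewrite -hp // h0.
Qed.

(** The weights multiply as the table prescribes ([split_weight_mul]): the three frame
    vectors have weights x, y and (x y)^-1, with product 1, and the dual vectors the
    inverse weights. *)
Definition split_weight (F : fieldType) (x y : F) (k : nat) : F :=
  nth 1 [:: 1; 1; x; y; (x * y)^-1; x^-1; y^-1; x * y] k.

Lemma split_weight_mul (F : fieldType) (x y : F) i j p : x != 0 -> y != 0 ->
  (i < 8)%N -> (j < 8)%N -> p \in split_mul i j ->
  split_weight x y p.2 = split_weight x y i * split_weight x y j.
Proof.
move=> x0 y0; move: i j => [|[|[|[|[|[|[|[|]]]]]]]] // [|[|[|[|[|[|[|[|]]]]]]]] // _ _;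
  rewrite /split_mul /= ?inE => // H; rewrite /split_weight;
  by [move/eqP: H => -> /=; field; rewrite ?x0 ?y0 |
      case/orP: H => /eqP -> /=; field; rewrite ?x0 ?y0].
Qed.

Lemma split_mul_lt i j p : (i < 8)%N -> (j < 8)%N -> p \in split_mul i j ->
  (p.2 < 8)%N.
Proof.
move=> i8 j8; case: (split_mulP i8 j8) => [|q q8|]; rewrite ?inE //.
  by move/eqP->.
by case/orP=> /eqP->.
Qed.

Section SplitTorus.
Variable F : numClosedFieldType.
Local Notation oct := 'cV[F]_(cd_dim 3).
Variable b : nat -> oct.
Hypothesis bP : split_basis b.
Local Notation P := (basis_mx b).

Definition split_torus_elt (x y : F) : 'M[F]_(cd_dim 3) :=
  P *m @tdiag F (cd_dim 3) (fun k => split_weight x y k) *m invmx P.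

Definition split_torus : set 'M[F]_(cd_dim 3) :=
  [set g | exists x y, [/\ x != 0, y != 0 & g = split_torus_elt x y]].

Let PU : P \in unitmx := basis_mx_unit bP.

Lemma split_torus_eltK x y : invmx P *m split_torus_elt x y *m P =
  @tdiag F (cd_dim 3) (fun k => split_weight x y k).
Proof. by rewrite /split_torus_elt !mulmxA mulVmx // mul1mx mulmxKV. Qed.

Lemma split_torus_eltM x y x' y' :
  split_torus_elt x y *m split_torus_elt x' y' = split_torus_elt (x * x') (y * y').
Proof.
rewrite /split_torus_elt !mulmxA mulmxKV // -[P *m _ *m tdiag _]mulmxA tdiagM.
congr (_ *m diag_mx _ *m _); apply/rowP => k; rewrite !mxE.
by case: k => [[|[|[|[|[|[|[|[|]]]]]]]] //= ?];
  rewrite /split_weight /= ?mulr1 // -?invfM // 1?[_ * (x' * _)]mulrACA.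
Qed.

Lemma mul_basis_mx_delta k (k8 : (k < 8)%N) : P *m delta_mx (Ordinal k8) 0 = b k.
Proof.
rewrite basis_mx_mul (bigD1 (Ordinal k8)) //= mxE !eqxx scale1r big1 ?addr0 // => i ik.
by rewrite mxE (negPf ik) scale0r.
Qed.

Lemma split_torus_elt_basis x y k : (k < 8)%N ->
  split_torus_elt x y *m b k = split_weight x y k *: b k.
Proof.
move=> k8; rewrite -!(mul_basis_mx_delta k8) /split_torus_elt -!mulmxA mulKmx //.
rewrite scalemxAr; congr (_ *m _); apply/matrixP => i j; rewrite !ord1.
rewrite /tdiag mul_diag_mx !mxE eqxx andbT /=.
by case: eqP => [->|]; rewrite ?mulr0.
Qed.

Lemma eq_mulmx_basis (g h : 'M[F]_(cd_dim 3)) :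
  (forall k, (k < 8)%N -> g *m b k = h *m b k) -> g = h.
Proof.
move=> E; suff : g *m P = h *m P by apply: (can_inj (mulmxK PU)).
apply/matrixP => i j; have := congr1 (fun v : oct => v i 0) (E _ (ltn_ord j)).
by rewrite !mxE => Eij; rewrite -[LHS]/(\sum_k _) -[RHS]/(\sum_k _);
   under eq_bigr do rewrite mxE; under [RHS]eq_bigr do rewrite mxE.
Qed.

Lemma split_torus_unit x y : x != 0 -> y != 0 -> split_torus_elt x y \in unitmx.
Proof.
move=> x0 y0; rewrite !unitmx_mul PU unitmx_inv PU andbT /=.
have [] // := @diag_torus_tdiag F (cd_dim 3) (fun k => split_weight x y k).
by move=> [[|[|[|[|[|[|[|[|]]]]]]]] //= ?];
  rewrite /split_weight /= ?oner_neq0 // ?invr_neq0 // mulf_neq0.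
Qed.

Lemma split_torus_elt1 : split_torus_elt 1 1 = 1%:M.
Proof.
apply: eq_mulmx_basis => k k8; rewrite split_torus_elt_basis // mul1mx.
by move: k k8 => [|[|[|[|[|[|[|[|]]]]]]]] // _;
  rewrite /split_weight /= ?mulr1 ?invr1 scale1r.
Qed.

Lemma split_torus_G2 : split_torus `<=` G2 F.
Proof.
move=> _ [x [y [x0 y0 ->]]]; split; first exact: split_torus_unit.
move=> u v; rewrite -!omulE.
have [c ->] := split_basis_span bP u; have [d ->] := split_basis_span bP v.
rewrite !omul_suml !mulmx_sumr omul_suml; apply: eq_bigr => i _.
rewrite !omul_sumr mulmx_sumr; apply: eq_bigr => j _.
have -> : split_torus_elt x y *m (c i *: b i ** (d j *: b j)) =
    (c i * d j) *: (split_torus_elt x y *m (b i ** b j)).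
  by rewrite omulZl omulZr scalerA -scalemxAr.
rewrite -!scalemxAr !split_torus_elt_basis // !(omulZl, omulZr).
have -> : split_torus_elt x y *m (b i ** b j) =
    (split_weight x y i * split_weight x y j) *: (b i ** b j).
  have [_ _ _ bM] := bP; rewrite bM // mulmx_sumr scaler_sumr.
  rewrite big_seq [RHS]big_seq; apply: eq_bigr => p pij.
  rewrite -scalemxAr split_torus_elt_basis ?(split_mul_lt _ _ pij) //.
  by rewrite (split_weight_mul x0 y0 _ _ pij) // !scalerA mulrC.
by rewrite !scalerA; congr (_ *: _); ring.
Qed.

Lemma split_torus_algebraic : algebraic_group split_torus.
Proof.
split; last first.
  split.
  - by move=> _ [x [y [x0 y0 ->]]]; exact: split_torus_unit.
  - by exists 1, 1; rewrite oner_neq0 split_torus_elt1.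
  - move=> _ _ [x [y [x0 y0 ->]]] [x' [y' [x'0 y'0 ->]]].
    by exists (x * x'), (y * y'); rewrite split_torus_eltM !mulf_neq0.
  move=> _ [x [y [x0 y0 ->]]]; exists x^-1, y^-1; rewrite !invr_neq0 //; split=> //.
  apply: (can_inj (mulKmx (split_torus_unit x0 y0))).
  rewrite mulmxV ?split_torus_unit // split_torus_eltM !mulfV //.
  by rewrite split_torus_elt1.
apply: gl_closedP => [_ [x [y [x0 y0 ->]]]|g gU g0]; first exact: split_torus_unit.
pose e (g : 'M_(cd_dim 3)) i j := (invmx P *m g *m P) (@inord 7 i) (@inord 7 j).
have eE x y i j : (i < 8)%N -> (j < 8)%N ->
    e (split_torus_elt x y) i j = split_weight x y i *+ (i == j)%N.
  move=> i8 j8; rewrite /e split_torus_eltK.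
  by rewrite /tdiag !mxE inordK // -val_eqE /= !inordK.
have er i j : regular_on setT (fun g => e g i j) by exact: regular_conj.
have vanish h : regular_on setT h ->
    (forall x y, x != 0 -> y != 0 -> h (split_torus_elt x y) = 0) -> h g = 0.
  by move=> rh h0; apply: g0 => // _ [x [y [x0 y0 ->]]]; apply: h0.
(* The equations of the torus: diagonal, trivial on b 0 and b 1, and with the
   relations between the other weights that express them by those of b 2 and b 3. *)
have off i j : (i < 8)%N -> (j < 8)%N -> i != j -> e g i j = 0.
  move=> i8 j8 ij; apply: (vanish (fun g => e g i j)) => // x y _ _.
  by rewrite eE // (negPf ij).
have e1 k : (k < 2)%N -> e g k k = 1.
  move=> k2; apply/eqP; rewrite -subr_eq0; apply/eqP.
  apply: (vanish (fun g => e g k k - 1)).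
    by apply: regularD => //; exact: regular_cst.
  move=> x y _ _; rewrite eE ?(leq_trans k2) // eqxx mulr1n.
  by case: k k2 => [|[|]] // _; rewrite /split_weight subrr.
have eM i j k : (i < 8)%N -> (j < 8)%N -> (k < 8)%N ->
    (forall x y : F, x != 0 -> y != 0 ->
       split_weight x y i * split_weight x y j = split_weight x y k) ->
    e g i i * e g j j = e g k k.
  move=> i8 j8 k8 W; apply/eqP; rewrite -subr_eq0 -mulN1r; apply/eqP.
  apply: (vanish (fun g => e g i i * e g j j + -1 * e g k k)).
    apply: regularD; apply: regularM => //; exact: regular_cst.
  by move=> x y x0 y0; rewrite !eE // !eqxx !mulr1n W // mulN1r subrr.
have e25 : e g 2%N 2%N * e g 5%N 5%N = 1.
  by rewrite (eM _ _ 0%N) ?e1 // => x y x0 y0; rewrite /split_weight /= mulfV.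
have e36 : e g 3%N 3%N * e g 6%N 6%N = 1.
  by rewrite (eM _ _ 0%N) ?e1 // => x y x0 y0; rewrite /split_weight /= mulfV.
have e23 : e g 2%N 2%N * e g 3%N 3%N = e g 7%N 7%N by apply: eM.
have e47 : e g 4%N 4%N * e g 7%N 7%N = 1.
  rewrite (eM _ _ 0%N) ?e1 // => x y x0 y0; rewrite /split_weight /= mulVf //.
  by rewrite mulf_neq0.
set x := e g 2%N 2%N in e25 e23; set y := e g 3%N 3%N in e36 e23.
have inv1 (u v : F) : u * v = 1 -> v = u^-1.
  move=> uv; have u0 : u != 0.
    by apply: contra_eq_neq uv => ->; rewrite mul0r eq_sym oner_eq0.
  by rewrite -[v](mulKf u0) uv mulr1.
have neq0 (u v : F) : u * v = 1 -> u != 0.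
  by move=> uv; apply: contra_eq_neq uv => ->; rewrite mul0r eq_sym oner_eq0.
exists x, y; split; [exact: neq0 e25 | exact: neq0 e36 |].
have -> : g = P *m (invmx P *m g *m P) *m invmx P.
  by rewrite !mulmxA mulmxV // mul1mx mulmxK.
rewrite /split_torus_elt; congr (_ *m _ *m _); apply/matrixP => i j.
have -> : (invmx P *m g *m P) i j = e g i j by rewrite /e !inord_val.
rewrite /tdiag [RHS]mxE [in RHS]mxE.
have [<-|ij] := eqVneq i j; last by rewrite off ?ltn_ord.
rewrite mulr1n; case: i => [[|[|[|[|[|[|[|[|]]]]]]]] //= i8]; rewrite /split_weight /=.
- exact: e1. - exact: e1.
- by rewrite e23; apply: inv1; rewrite mulrC.
- exact: inv1. - exact: inv1.
Qed.

Lemma split_torus_is_torus : is_torus split_torus.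
Proof.
split; first exact: split_torus_algebraic.
pose f (d : 'M[F]_2) := split_torus_elt (d 0 0) (d 1 1).
pose f' (g : 'M[F]_(cd_dim 3)) : 'M[F]_2 := tdiag (fun i : 'I_2 =>
   (invmx P *m g *m P) (@inord 7 i.+2) (@inord 7 i.+2)).
have f'E x y : x != 0 -> y != 0 ->
    f' (split_torus_elt x y) = tdiag (fun i : 'I_2 => if i == 0 then x else y).
  move=> x0 y0; rewrite /f' split_torus_eltK; congr diag_mx; apply/rowP => i.
  rewrite /tdiag !mxE eqxx mulr1n.
  by case: i => [[|[|]]] //= i2; rewrite inordK.
exists 2%N, f, f'; split.
- split.
  + move=> d /diag_torusP[t t0 ->]; rewrite /f /tdiag !mxE !eqxx !mulr1n.
    by exists (t 0), (t 1).
  + move=> d e /diag_torusP[t t0 ->] /diag_torusP[s s0 ->].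
    by rewrite tdiagM /f split_torus_eltM /tdiag !mxE !eqxx !mulr1n.
  move=> i j; have dg := regular_entry (@diag_torus F 2).
  have dV := regular_invdet (@diag_torus F 2).
  have prod2 (t : 'I_2 -> F) : \prod_i t i = t 0 * t 1.
    by rewrite big_ord_recl big_ord1; congr (_ * t _); apply: val_inj.
  have rw k : regular_on (@diag_torus F 2)
      (fun d => split_weight (d 0 0) (d 1 1) k).
    have rV l m : (forall t : 'I_2 -> F, (forall i, t i != 0) ->
        (t m)^-1 = t l * (t 0 * t 1)^-1) ->
        regular_on (@diag_torus F 2) (fun d => (d m m)^-1).
      move=> tE; have [p E] := regularM (dg l l) dV; exists p => d Td.
      rewrite -E //; case/diag_torusP: Td => t t0 ->.
      rewrite /tdiag !mxE !eqxx !mulr1n tE // -/(tdiag _) det_tdiag.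
      by rewrite prod2.
    have r1 := regular_cst (@diag_torus F 2) 1.
    move: k => [|[|[|[|[|[|[|[|k]]]]]]]]; rewrite /split_weight //=.
    - have [p E] := dV; exists p => d Td; rewrite -E //.
      case/diag_torusP: Td => t t0 ->; rewrite det_tdiag /tdiag !mxE !eqxx !mulr1n.
      by rewrite prod2.
    - by apply: (rV 1) => t t0; rewrite invfM mulrCA mulfV ?mulr1.
    - by apply: (rV 0) => t t0; rewrite invfM mulrA mulfV ?mul1r.
    - exact: regularM.
    - by rewrite nth_nil.
  have [p E] := regular_sum (index_enum 'I_(cd_dim 3)) (fun k => regularM
    (regularM (regular_cst _ (P i k)) (rw k)) (regular_cst _ (invmx P k j))).
  exists p => d Td; rewrite -E // /f /split_torus_elt mxE; apply: eq_bigr => k _.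
  by rewrite /tdiag mul_mx_diag !mxE.
- split.
  + move=> _ [x [y [x0 y0 ->]]]; rewrite f'E //; apply: diag_torus_tdiag => i.
    by case: ifP.
  + move=> _ _ [x [y [x0 y0 ->]]] [x' [y' [x'0 y'0 ->]]].
    rewrite split_torus_eltM !f'E ?mulf_neq0 // tdiagM; congr diag_mx.
    by apply/rowP => i; rewrite !mxE; case: ifP.
  move=> i j; have [p E] : regular_on split_torus (fun g => f' g i j).
    have [->|ij] := eqVneq i j.
      have [p E] := regular_conj split_torus (invmx P) P
        (@inord 7 j.+2) (@inord 7 j.+2).
      by exists p => g Tg; rewrite -E // /f' /tdiag mxE eqxx mulr1n mxE.
    have [p E] := regular_cst split_torus 0; exists p => g Tg.
    by rewrite -E // /f' /tdiag mxE (negPf ij).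
  by exists p.
- move=> d /diag_torusP[t t0 ->]; rewrite /f f'E; last 2 first.
  + by rewrite /tdiag !mxE eqxx mulr1n.
  + by rewrite /tdiag !mxE eqxx mulr1n.
  congr diag_mx; apply/rowP => i; rewrite /tdiag !mxE !eqxx !mulr1n.
  by case: i => [[|[|]]] //= i2; congr t; apply: val_inj.
move=> _ [x [y [x0 y0 ->]]]; rewrite f'E // /f /tdiag !mxE !eqxx !mulr1n.
by [].
Qed.
End SplitTorus.

(** * Tori of automorphisms lie in the torus of a split basis *)

Section Weights.
Variable F : numClosedFieldType.
Local Notation oct := 'cV[F]_(cd_dim 3).
Local Notation "1o" := (oone F).
Variable T : set 'M[F]_(cd_dim 3).
Hypotheses (TT : is_torus T) (TG2 : T `<=` G2 F).

Lemma torus_weight_basis : exists (Q : 'M[F]_(cd_dim 3))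
    (chi : 'I_(cd_dim 3) -> 'M[F]_(cd_dim 3) -> F),
  Q \in unitmx /\ forall g, T g -> forall j, g *m col j Q = chi j g *: col j Q.
Proof.
have [P Pu PT] := @torus_diagonalizable F 7 T TT.
exists (invmx P), (fun j g => (P *m g *m invmx P) j j); split.
  by rewrite unitmx_inv.
move=> g Tg j; have /diag_mxP[d Ed] := PT g Tg.
have Eg : g *m invmx P = invmx P *m diag_mx d.
  by rewrite -Ed !mulmxA mulVmx // mul1mx.
rewrite colE mulmxA Eg Ed -mulmxA scalemxAr; congr (_ *m _).
apply/matrixP => i k; rewrite mul_diag_mx !mxE eqxx mulr1n.
by case: eqP => [->|]; rewrite ?mulr0.
Qed.

Variables (Q : 'M[F]_(cd_dim 3)) (chi : 'I_(cd_dim 3) -> 'M[F]_(cd_dim 3) -> F).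
Hypotheses (Qu : Q \in unitmx)
  (chiP : forall g, T g -> forall j, g *m col j Q = chi j g *: col j Q).

Local Notation p j := (col j Q).

Lemma mulmx_col (c : oct) : Q *m c = \sum_j c j 0 *: p j.
Proof.
apply/matrixP => i k; rewrite ord1 mxE summxE; apply: eq_bigr => j _.
by rewrite !mxE mulrC.
Qed.

Lemma weight_span (x : oct) : exists c : oct, x = \sum_j c j 0 *: p j.
Proof. by exists (invmx Q *m x); rewrite -mulmx_col mulKVmx. Qed.

Lemma weight_free (c : oct) : \sum_j c j 0 *: p j = 0 -> c = 0.
Proof. by rewrite -mulmx_col => Qc; rewrite -(mulKmx Qu c) Qc mulmx0. Qed.

Lemma weight_neq0 j : p j != 0.
Proof.
apply/eqP => pj; have /matrixP/(_ j 0) : delta_mx j 0 = 0 :> oct.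
  by rewrite -(mulKmx Qu (delta_mx j 0)) -colE pj mulmx0.
by rewrite !mxE !eqxx => /eqP; rewrite oner_eq0.
Qed.

Lemma weight_eq0 (f : oct -> oct) : linear f -> (forall j, f (p j) = 0) ->
  forall x, f x = 0.
Proof.
move=> fL f0 x; have [c ->] := weight_span x.
pose f' : {linear oct -> oct} := HB.pack f (GRing.isLinear.Build F oct oct *:%R f fL).
rewrite -[f]/(f' : oct -> oct) linear_sum big1 // => j _.
by rewrite linearZ /= f0 scaler0.
Qed.

Lemma weight_sqr_eq1 j : (forall g, T g -> chi j g * chi j g = 1) ->
  forall g, T g -> chi j g = 1.
Proof.
move=> chi2 g Tg; have [h Th gh] := @torus_sqrt F 7 T TT g Tg.
have := chiP Tg j; rewrite {1}gh -mulmxA !chiP // -scalemxAr chiP // scalerA chi2 //.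
move/eqP; rewrite -subr_eq0 -scalerBl scaler_eq0 (negPf (weight_neq0 j)) orbF.
by rewrite subr_eq0 eq_sym => /eqP.
Qed.

Lemma weight_polar i j : opolar (p i) (p j) != 0 ->
  forall g, T g -> chi i g * chi j g = 1.
Proof.
move=> ij0 g Tg; have := G2_polar (TG2 Tg) (p i) (p j).
rewrite !chiP // opolarZl opolarZr mulrA => E.
by apply: (mulIf ij0); rewrite E mul1r.
Qed.

(** The polar form pairs a weight with its inverse only.  As its determinant on the
    weight basis is nonzero, some term of the Leibniz expansion is nonzero, and its
    permutation matches each weight with its inverse. *)
Lemma weight_opp_perm : exists s : {perm 'I_(cd_dim 3)},
  forall i g, T g -> chi i g * chi (s i) g = 1.
Proof.
pose G : 'M[F]_(cd_dim 3) := \matrix_(i, j) opolar (p i) (p j).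
have Gu : \det G != 0.
  rewrite -unitfE -unitmxE -row_free_unit; apply: inj_row_free => v vG.
  apply: trmx_inj; rewrite trmx0; apply: weight_free; apply: opolar_nondeg => y.
  have [c ->] := weight_span y; rewrite opolar_sumr big1 // => j _.
  rewrite opolarZr opolarC opolar_sumr (eq_bigr (fun i => v 0 i * G i j)).
    by move/rowP/(_ j): vG; rewrite !mxE => ->; rewrite mulr0.
  by move=> i _; rewrite opolarZr opolarC !mxE.
have /existsP[s sG] : [exists s : {perm 'I_(cd_dim 3)}, \prod_i G i (s i) != 0].
  apply: contraNT Gu => /existsPn s0; rewrite /determinant big1 // => s _.
  by have := s0 s; rewrite negbK => /eqP->; rewrite mulr0.
exists s => i g Tg; apply: weight_polar => //.
by move/prodf_neq0: sG => /(_ i isT); rewrite mxE.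
Qed.

Definition trivial_weights := [set j | `[< forall g, T g -> chi j g = 1 >]]%SET.

(** The permutation of [weight_opp_perm] preserves the indices of nontrivial weight.
    A nontrivial weight differs from its inverse, so one can select one weight in each
    pair of inverses; the permutation then exchanges selected and unselected indices,
    whose numbers are therefore equal. *)
Lemma even_trivial_weights : ~~ odd #|trivial_weights|.
Proof.
have [s sP] := weight_opp_perm.
pose eqw i j := `[< forall g, T g -> chi i g = chi j g >].
pose opp i j := `[< forall g, T g -> chi i g * chi j g = 1 >].
have neq0 i g : T g -> chi i g != 0.
  move=> Tg; apply: contra_eq_neq (sP i g Tg) => ->.
  by rewrite mul0r eq_sym oner_eq0.
have oppE i j : opp i j = eqw i (s j).
  apply/asboolP/asboolP => H g Tg.
    by apply: (mulIf (neq0 j g Tg)); rewrite H // mulrC sP.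
  by rewrite H // mulrC sP.
have eqwE i j : eqw i j = opp i (s j).
  apply/asboolP/asboolP => H g Tg; first by rewrite H // sP.
  by apply: (mulIf (neq0 (s j) g Tg)); rewrite H // sP.
(* [rep j] depends only on the pair formed by the weight of j and its inverse, because
   [pick] sees only the extension of the predicate [cls j]. *)
pose cls j i := eqw i j || opp i j.
have clss j : cls (s j) =1 cls j by move=> i; rewrite /cls -oppE -eqwE orbC.
pose rep j := odflt j [pick i | cls j i].
have repP j : cls j (rep j).
  rewrite /rep; case: pickP => //= /(_ j).
  by rewrite /cls /eqw (introT (asboolP _)).
have reps j : rep (s j) = rep j.
  rewrite /rep (eq_pick (clss j)); case: pickP => // /(_ j).
  by rewrite /cls /eqw (introT (asboolP _)).
pose sgn j := eqw (rep j) j.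
pose J := trivial_weights.
have Js j : (s j \in J) = (j \in J).
  rewrite !inE; apply/asboolP/asboolP => H g Tg.
    by rewrite -(sP j g Tg) H // mulr1.
  by rewrite -(sP j g Tg) H // mul1r.
have sgns j : j \notin J -> sgn (s j) = ~~ sgn j.
  move=> jJ; rewrite /sgn reps -oppE.
  have := repP j; rewrite /cls; case E: (eqw _ _) => /=; last by move->.
  move=> _; apply/negP => /asboolP H; move/asboolP: E => E.
  move/negP: jJ; apply; rewrite inE; apply/asboolP; apply: weight_sqr_eq1 => g Tg.
  by rewrite -{1}E // H.
pose S := [set j | sgn j]%SET.
pose A := (~: J :&: S)%SET; pose B := (~: J :\: S)%SET.
have inA j : (j \in A) = (j \notin J) && sgn j.
  by rewrite finset.in_setI finset.in_setC [j \in S]finset.in_set.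
have inB j : (j \in B) = (j \notin J) && ~~ sgn j.
  by rewrite finset.in_setD finset.in_setC [j \in S]finset.in_set andbC.
have AB : #|A| = #|B|.
  apply/eqP; rewrite eqn_leq; apply/andP; split.
    rewrite -(card_imset _ (@perm_inj _ s)); apply: subset_leq_card.
    apply/fintype.subsetP => _ /imsetP[j + ->]; rewrite inA inB Js => /andP[jJ sj].
    by rewrite jJ sgns // negbK.
  rewrite -(card_imset _ (@perm_inj _ s)); apply: subset_leq_card.
  apply/fintype.subsetP => _ /imsetP[j + ->]; rewrite inA inB Js => /andP[jJ sj].
  by rewrite jJ sgns.
have := cardsC J; rewrite -(cardsID S (~: J)%SET) -/A -/B AB addnn card_ord.
by move/(congr1 odd); rewrite oddD odd_double addbF => ->.
Qed.

Lemma trivial_weightP j :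
  reflect (forall g, T g -> chi j g = 1) (j \in trivial_weights).
Proof. by rewrite inE; apply: asboolP. Qed.

Lemma trivial_weight_fixed j : j \in trivial_weights ->
  forall g, T g -> g *m p j = p j.
Proof. by move=> /trivial_weightP jJ g Tg; rewrite chiP // jJ // scale1r. Qed.

(** The unit is fixed, so it is a combination of weight vectors of trivial weight; their
    number is even and not zero. *)
Lemma card_trivial_weights : (1 < #|trivial_weights|)%N.
Proof.
suff : #|trivial_weights| != 0%N.
  by have := even_trivial_weights; case: #|_| => [|[|]].
apply/eqP => /cards0_eq J0; have [c Ec] := weight_span (oone F).
suff c0 : c = 0.
  have := otrace1 F; rewrite Ec c0 big1 => [|j _]; last by rewrite mxE scale0r.
  by rewrite [LHS]opolar0r => /esym/eqP; rewrite (negPf (two_neq0 F)).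
apply/matrixP => j k; rewrite ord1 mxE; apply/eqP/negPn/negP => cj.
suff : j \in trivial_weights by rewrite J0 inE.
apply/trivial_weightP => g Tg; have := G2_one (TG2 Tg).
rewrite Ec mulmx_sumr => /eqP; rewrite -subr_eq0 -sumrB => /eqP E.
have /matrixP/(_ j 0) : (\col_i (c i 0 * (chi i g - 1)) : oct) = 0.
  apply: weight_free; rewrite -[RHS]E; apply: eq_bigr => i _.
  by rewrite mxE -scalemxAr chiP // scalerA mulrBr mulr1 scalerBl.
by rewrite !mxE => /eqP; rewrite mulf_eq0 (negPf cj) subr_eq0 => /eqP.
Qed.

Lemma fixed_im_part (x : oct) : (forall g, T g -> g *m x = x) ->
  forall g, T g -> g *m im_part x = im_part x.
Proof.
by move=> gx g Tg; rewrite mulmxBr gx // -scalemxAr (G2_one (TG2 Tg)).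
Qed.

(** The fixed vectors are not all multiples of 1, and the polar form is nondegenerate on
    those orthogonal to 1 because it pairs trivial weights with trivial weights.  Hence
    some of them have nonzero norm. *)
Lemma fixed_unit : exists u : oct, [/\ otrace u = 0, oct_norm u = -1 &
  forall g, T g -> g *m u = u].
Proof.
have /card_gt1P[j [k [jJ kJ jk]]] := card_trivial_weights.
have [l lJ l0] : exists2 l, l \in trivial_weights & im_part (p l) != 0.
  case: (eqVneq (im_part (p j)) 0) => [pj|]; last by exists j.
  case: (eqVneq (im_part (p k)) 0) => [pk|]; last by exists k.
  move/eqP: pj; rewrite subr_eq0 => /eqP; set a := _ / _ => pj.
  move/eqP: pk; rewrite subr_eq0 => /eqP; set a' := _ / _ => pk.
  have a0 : a' != 0.
    by apply: contraNneq (weight_neq0 k) => a0; rewrite pk a0 scale0r.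
  have /matrixP/(_ j 0) : a' *: delta_mx j 0 - a *: delta_mx k 0 = 0 :> oct.
    apply: (can_inj (mulKmx Qu)); rewrite mulmx0 mulmxBr -!scalemxAr -!colE pj pk.
    by rewrite !scalerA mulrC subrr.
  rewrite !mxE !eqxx (negPf jk) mulr1 mulr0 subr0 => /eqP.
  by rewrite (negPf a0).
pose u0 := im_part (p l); have tu0 : otrace u0 = 0 := otrace_im_part _.
have u0g := fixed_im_part (trivial_weight_fixed lJ).
rewrite -/u0 in u0g l0.
have [m um] : exists m, opolar u0 (p m) != 0.
  apply/not_existsP => H; move/eqP: l0; apply; apply: opolar_nondeg => y.
  have [c ->] := weight_span y; rewrite opolar_sumr big1 // => i _.
  by rewrite opolarZr; move: (H i) => /negP/negPn/eqP->; rewrite mulr0.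
have mJ : m \in trivial_weights.
  apply/trivial_weightP => g Tg; apply: (mulIf um).
  by rewrite mul1r -[in RHS](G2_polar (TG2 Tg)) u0g // chiP // opolarZr.
pose w := im_part (p m); have tw : otrace w = 0 := otrace_im_part _.
have wg := fixed_im_part (trivial_weight_fixed mJ); rewrite -/w in wg.
have uw : opolar u0 w != 0.
  rewrite /w /im_part opolarDr opolarNr opolarZr (opolarC u0 1o).
  by rewrite -/(otrace u0) tu0 mulr0 subr0.
(* Two isotropic vectors that are not orthogonal have a sum that is not isotropic. *)
have [y [ty yg qy]] : exists y, [/\ otrace y = 0,
    forall g, T g -> g *m y = y & oct_norm y != 0].
  case: (eqVneq (oct_norm u0) 0) => [qu|]; last by exists u0.
  case: (eqVneq (oct_norm w) 0) => [qw|]; last by exists w.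
  exists (u0 + w); rewrite otraceD tu0 tw addr0 oct_normD qu qw !add0r; split=> // g Tg.
  by rewrite mulmxDr u0g ?wg.
exists (sqrtC (- (oct_norm y)^-1) *: y); split.
- by rewrite otraceZ ty mulr0.
- by rewrite oct_normZ sqrtCK mulNr mulVf.
by move=> g Tg; rewrite -scalemxAr yg.
Qed.

(** The projections of the weight vectors to the Peirce space are weight vectors and
    span it.  The trilinear map x (y z) is nonzero on the Peirce space, hence on some
    three of them; rescaling one of the three normalizes their product. *)
Lemma weight_frame (u : oct) : otrace u = 0 -> oct_norm u = -1 ->
    (forall g, T g -> g *m u = u) ->
  exists x y z : oct, split_frame u x y z /\
    forall g, T g -> exists a b c,
      [/\ g *m x = a *: x, g *m y = b *: y & g *m z = c *: z].
Proof.
move=> tu qu ug; pose V j := peirce_proj u (p j).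
have VP j : peirce u (V j) by apply: peirce_projP.
have Vg g j : T g -> g *m V j = chi j g *: V j.
  move=> Tg; rewrite /V (G2_peirce_proj (TG2 Tg)) ?ug // chiP //.
  have := peirce_proj_linear u (chi j g) (p j) 0.
  have -> : peirce_proj u 0 = 0.
    have := peirce_proj_linear u (-1) 0 0.
    by rewrite scaler0 addr0 scaleN1r addNr.
  by rewrite !addr0.
have [j [k [l N0]]] : exists j k l, V j ** (V k ** V l) != 0.
  apply/not_existsP => H.
  have {}H j k l : V j ** (V k ** V l) = 0.
    by apply/eqP/negPn/negP => n0; apply: (H j); exists k, l.
  have [x [y [Vx Vy xy0]]] := peirce_mul_neq0 tu qu.
  have Wxy := peirce_mul tu Vx Vy.
  have H1 k l z : peirce_proj u z ** (V k ** V l) = 0.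
    apply: (weight_eq0 (f := fun z => peirce_proj u z ** (V k ** V l))) => [a s t|i].
      rewrite peirce_proj_linear.
      move: (peirce_proj u s) (peirce_proj u t) => s' t'.
      by rewrite omulDl omulZl.
    exact: H.
  have H2 l z w : peirce_proj u z ** (peirce_proj u w ** V l) = 0.
    apply: (weight_eq0 (f := fun w =>
      peirce_proj u z ** (peirce_proj u w ** V l))) => [a s t|i].
      rewrite peirce_proj_linear.
      move: (peirce_proj u s) (peirce_proj u t) (peirce_proj u z) => s' t' z'.
      by rewrite omulDl omulZl omulDr omulZr.
    exact: H1.
  have H3 z w t : peirce_proj u z ** (peirce_proj u w ** peirce_proj u t) = 0.
    apply: (weight_eq0 (f := fun t => peirce_proj u z **
      (peirce_proj u w ** peirce_proj u t))) => [a s r|i].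
      rewrite peirce_proj_linear.
      move: (peirce_proj u s) (peirce_proj u r) (peirce_proj u z) => s' r' z'.
      by move: (peirce_proj u w) => w'; rewrite !omulDr !omulZr.
    exact: H2.
  move/eqP: xy0; apply; apply: (peirce_opp_eq0 tu qu Wxy) => z Vz.
  have := H3 z x y; rewrite !peirce_proj_id // (peirce_mul_opp tu Vz Wxy).
  move/(congr1 (@otrace F)); rewrite otraceZ peirce_idem_trace // mulr1 [RHS]opolar0r.
  by move/eqP; rewrite oppr_eq0 => /eqP.
have E := peirce_mul_opp tu (VP j) (peirce_mul tu (VP k) (VP l)).
set a := - opolar _ _ in E.
have a0 : a != 0 by apply: contraNneq N0 => a0; rewrite E a0 scale0r.
exists (a^-1 *: V j), (V k), (V l); split.
  split=> //; first by split=> //; apply: peirceZ.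
  by rewrite omulZl E scalerA mulVf // scale1r.
move=> g Tg; exists (chi j g), (chi k g), (chi l g); rewrite -!scalemxAr !Vg //.
by split=> //; rewrite !scalerA mulrC.
Qed.
End Weights.

Lemma torus_sub_split (F : numClosedFieldType) (T : set 'M[F]_(cd_dim 3)) :
  is_torus T -> T `<=` G2 F ->
  exists2 b, split_basis b & T `<=` split_torus b.
Proof.
move=> TT TG2; have [Q [chi [Qu chiP]]] := torus_weight_basis TT.
have [u [tu qu ug]] := fixed_unit TT TG2 Qu chiP.
have [x [y [z [fr frT]]]] := weight_frame TG2 Qu chiP tu qu ug.
have bP := frame_basisP fr; exists (frame_basis u x y z) => // g Tg.
have gG := TG2 _ Tg; have [a [b [c [gx gy gz]]]] := frT g Tg.
have ge : g *m peirce_idem u = peirce_idem u.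
  by rewrite /peirce_idem -scalemxAr mulmxDr (G2_one gG) ug.
have [_ _ _ E] := fr.
have abc : a * b * c = 1.
  have := ge; rewrite -E !(G2_mul gG) gx gy gz !(omulZl, omulZr) !scalerA E.
  move/(congr1 (@otrace F)); rewrite otraceZ peirce_idem_trace // mulr1 => <-; ring.
have a0 : a != 0 by apply: contra_eq_neq abc => ->; rewrite !mul0r eq_sym oner_eq0.
have b0 : b != 0.
  by apply: contra_eq_neq abc => ->; rewrite mulr0 !mul0r eq_sym oner_eq0.
have ab0 : a * b != 0 by rewrite mulf_neq0.
have Ec : c = (a * b)^-1 by rewrite -[LHS](mulKf ab0) abc mulr1.
exists a, b; split=> //; apply: (eq_mulmx_basis bP) => k k8.
rewrite split_torus_elt_basis //.
move: k k8 => [|[|[|[|[|[|[|[|]]]]]]]] // _; rewrite /frame_basis /split_weight /=.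
- by rewrite (G2_one gG) scale1r.
- by rewrite ge scale1r.
- by rewrite gz Ec.
- rewrite (G2_mul gG) gy gz omulZl omulZr scalerA Ec; congr (_ *: _).
  by field; rewrite a0 b0.
- rewrite (G2_mul gG) gz gx omulZl omulZr scalerA Ec; congr (_ *: _).
  by field; rewrite a0 b0.
by rewrite (G2_mul gG) gx gy omulZl omulZr scalerA.
Qed.

(** * Fixed points of a maximal torus *)

(** The torus is that of a split basis by maximality.  Its element with parameters 2 and
    3 has the eigenvalues 1, 2, 3, 1/6, 1/2, 1/3, 6 on b 1, ..., b 7. *)
Lemma card_CG_fixed (F : numClosedFieldType) (T : set 'M[F]_(cd_dim 3)) :
  maximal_torus (G2 F) T -> CG F `&` gl_fixed T #= `I_15.
Proof.
move=> [TT TG2 Tmax]; have [b bP Tb] := torus_sub_split TT TG2.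
have <- := Tmax _ (split_torus_is_torus bP) (split_torus_G2 bP) Tb.
apply: (card_fixed bP); first exact: split_torus_G2.
  move=> g [x [y [x0 y0 ->]]] k k8; exists (split_weight x y k).
  exact: split_torus_elt_basis.
exists (split_torus_elt b 2 3), (split_weight 2 3); split.
- by exists 2, 3; rewrite !pnatr_eq0.
(* Six times the eigenvalues, which makes them natural numbers. *)
- pose n := nth 0%N [:: 6; 6; 12; 18; 1; 3; 2; 36]%N.
  have nE k : k \in iota 1 7 -> split_weight 2 3 k = (n k)%:R / 6 :> F.
    have h2 : 2 != 0 :> F by rewrite pnatr_eq0.
    have h3 : 3 != 0 :> F by rewrite pnatr_eq0.
    have h6 : 6 != 0 :> F by rewrite pnatr_eq0.
    by rewrite !inE; do 6?[case/orP]; move/eqP->; rewrite /split_weight /n /=; field.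
  move=> i j iI jI; rewrite !nE // => /mulIf.
  rewrite invr_eq0 pnatr_eq0 => /(_ isT)/eqP; rewrite eqr_nat.
  move: iI jI; rewrite !inE.
  by do 6?[case/orP]; move=> /eqP->; do 6?[case/orP]; move=> /eqP->.
by move=> k; rewrite mem_iota => /andP[_ k8]; exact: split_torus_elt_basis.
Qed.

Theorem proposition4p1 (R : realType) (T : set 'M[R[i]]_(cd_dim 3))
    (hT : maximal_torus (G2 R[i]) T) :
  CG R[i] `&` gl_fixed T #= `I_15.
Proof. exact: (@card_CG_fixed R[i]). Qed.
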